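(* Let $\{X_t\}_{t\ge 0}$ be the Ornstein-Uhlenbeck dividend rate process and $\{\xi_t\}_{t\ge0}$ the market information process specified in the context. Then $\{\xi_t\}$ and $\{X_t\}$ are jointly Markov; that is, for all $0\le t\le u$ and all $a,b\in\mathbb R$, almost surely, $$\mathbb Q\left[\left.\{\xi_u<a\}\cap\{X_u<b\}\,\right|\,\{\xi_s\}_{0\le s\le t},\{X_s\}_{0\le s\le t}\right]=\mathbb Q\left[\left.\{\xi_u<a\}\cap\{X_u<b\}\,\right|\,\xi_t,X_t\right].$$
   Context: Work on a probability space $(\Omega,\mathcal F,\mathbb Q)$ carrying two independent standard one-dimensional Brownian motions $\{\beta_t\}_{t\ge0}$ and $\{B_t\}_{t\ge 0}$. Conditioning on a collection of random variables means conditioning on the $\sigma$-algebra they generate. Discount factor: $\pi_t=\exp\left(-\int_0^t r_s\,\mathrm ds\right)$, where the short rate $\{r_t\}_{t\ge0}$ is deterministic, and $\int_0^\infty \pi_u\,\mathrm du<\infty$. Dividend process: $\{X_t\}_{t\ge0}$ is the Ornstein-Uhlenbeck process with constant (deterministic) initial value $X_0$ solving $$\mathrm dX_t=\kappa(\theta-X_t)\,\mathrm dt+\psi\,\mathrm d\beta_t,$$ with constants $\kappa>0$, $\theta\in\mathbb R$, $\psi>0$. Thus $\{X_t\}$ is independent of $\{B_t\}$. Information process: for a constant $\sigma>0$, $$\xi_t=\sigma t\int_t^\infty \pi_u X_u\,\mathrm du+B_t,\qquad t\ge0.$$ *)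

(* Defs.v *)
From HB Require Import structures.
From mathcomp Require Import all_boot all_order all_algebra.
From mathcomp Require Import all_classical all_reals all_analysis.
From mathcomp Require Import measurable_realfun.

Set Implicit Arguments.
Unset Strict Implicit.
Unset Printing Implicit Defensive.

Import Order.TTheory GRing.Theory Num.Theory.
Import numFieldNormedType.Exports.

Local Open Scope classical_set_scope.
Local Open Scope ring_scope.

Section conditioning.
Context (d : measure_display) (T : measurableType d) (R : realType).
Implicit Types (P : probability T R) (F : set (T -> R)) (A C : set T).

(* The events [f \in B], for f in the collection F and B Borel.
   The sigma-algebra generated by F is <<s sigma_gens F >>. *)
Definition sigma_gens F : set (set T) :=
  \bigcup_(f in F) g_sigma_algebra_preimage f.

Definition indep P F1 F2 : Prop :=
  forall A1 A2, <<s sigma_gens F1 >> A1 -> <<s sigma_gens F2 >> A2 ->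
    P (A1 `&` A2) = (P A1 * P A2)%E.

(* f is a version of the conditional probability of A given the
   sigma-algebra generated by F. *)
Definition is_cond_prob P A F (f : T -> R) : Prop :=
  [/\ measurable_fun [set: g_sigma_algebraType (sigma_gens F)] f,
      P.-integrable setT (EFin \o f) &
      forall C, <<s sigma_gens F >> C ->
        (\int[P]_(w in C) (f w)%:E = P (A `&` C))%E].

(* A version of P[A | F]. It exists by [cond_probP] whenever A is an event and
   F consists of random variables; the default value 0 is then never used. *)
Definition cond_prob P A F : T -> R := xget (fun=> 0) (is_cond_prob P A F).

Lemma sigma_gens_measurable F :
  (forall f, F f -> measurable_fun setT f) ->
  <<s sigma_gens F >> `<=` measurable.
Proof.
move=> mF; apply: smallest_sub; first exact: sigma_algebra_measurable.
by move=> _ [f Ff] [B mB <-]; exact: mF.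
Qed.

Lemma cond_probP P A F : measurable A ->
  (forall f, F f -> measurable_fun setT f) ->
  is_cond_prob P A F (cond_prob P A F).
Proof.
move=> mA mF; apply: xgetPex.
have sub := sigma_gens_measurable mF.
pose S := g_sigma_algebraType (sigma_gens F).
pose j : T -> S := id.
have mj : measurable_fun setT j by move=> _ C mC; rewrite setTI; exact: sub.
pose J : {mfun T >-> S} := HB.pack j (isMeasurableFun.Build _ _ _ _ j mj).
pose Q : probability S R := distribution P J.
have PAoo : (P A < +oo)%E by rewrite ltey_eq fin_num_measure.
pose nuT : {charge set T -> \bar R} :=
  charge_of_finite_measure (mfrestr mA PAoo).
pose nuJ : {charge set S -> \bar R} := pushforward nuT j.
pose nu := nuJ mj.
have nuQ : nu `<< Q.
  apply: (@dominates_pushforward _ _ _ _ _ P nuT j mj).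
  apply/null_content_dominatesP => C mC PC0.
  apply/eqP; rewrite -measure_le0 -PC0.
  by apply: le_measure; rewrite ?inE//; exact: measurableI.
have iQ := Radon_Nikodym_integrable nuQ.
have fE : EFin \o (fine \o Radon_Nikodym nu Q) = Radon_Nikodym nu Q.
  by apply/funext => w /=; rewrite fineK// Radon_Nikodym_fin_num.
exists (fine \o Radon_Nikodym nu Q).
have mRN := measurable_int _ iQ.
have iP : P.-integrable setT (Radon_Nikodym nu Q).
  apply/integrableP; split.
    exact: (measurable_comp measurableT _ mRN mj).
  move/integrableP: (iQ) => [_]; apply: le_lt_trans.
  rewrite le_eqVlt; apply/orP; left; apply/eqP.
  rewrite [RHS](@ge0_integral_pushforward _ _ _ _ R j mj P setT)//.
  exact: (measurable_int _ (integrable_abse iQ)).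
split => //.
- by apply/measurable_EFinP; rewrite fE.
- by rewrite fE.
- move=> C mC.
  have <- : (\int[Q]_(w in C) Radon_Nikodym nu Q w =
             \int[P]_(w in C) (fine (Radon_Nikodym nu Q w))%:E)%E.
    rewrite (@integral_pushforward _ _ _ _ R j mj P C)//.
      by apply: eq_integral => w _ /=; rewrite fineK// Radon_Nikodym_fin_num.
    by apply: (integrableS measurableT _ _ iP) => //; exact: sub.
  by rewrite -Radon_Nikodym_integral// setIC.
Qed.

End conditioning.

Section processes.
Context (d : measure_display) (T : measurableType d) (R : realType).
Local Notation leb := (@lebesgue_measure R).
Implicit Types (P : probability T R) (t u : R).

(* Processes are families indexed by R of which only the times t >= 0 are
   ever constrained or used. *)

Definition continuous_paths (W : R -> T -> R) : Prop :=
  forall w, {within `[0, +oo[, continuous (fun t => W t w)}.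

(* The second parameter of [normal_prob] is the standard deviation; at the
   value 0 it is not a Dirac mass, whence the strict inequality. *)
Definition is_brownian P (W : R -> {RV P >-> R}) : Prop :=
  [/\ {ae P, forall w, W 0 w = 0},
      continuous_paths (fun t => W t),
      (forall t u, 0 <= t -> t <= u ->
        indep P [set (W s : T -> R) | s in `[0, t]]
                [set (fun w => W u w - W t w)]) &
      (forall t u, 0 <= t -> t < u -> forall D : set R, measurable D ->
        P [set w | D (W u w - W t w)] = normal_prob 0 (Num.sqrt (u - t)) D)].

(* dX_t = kappa (theta - X_t) dt + psi dbeta_t with X_0 = x0, in integral form.
   The diffusion coefficient being constant, the stochastic integral of psi
   over [0, t] is psi * (beta_t - beta_0). *)
Definition is_ornstein_uhlenbeck P (kappa theta psi x0 : R)
    (beta X : R -> {RV P >-> R}) : Prop :=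
  continuous_paths (fun t => X t) /\
  {ae P, forall w, forall t, 0 <= t ->
    X t w = x0 + \int[leb]_(s in `[0, t]) (kappa * (theta - X s w))
               + psi * (beta t w - beta 0 w)}.

Definition discount (r : R -> R) t : R := expR (- \int[leb]_(s in `[0, t]) r s).

Definition information (r : R -> R) (sigma : R) (X B : R -> T -> R) t : T -> R :=
  fun w => sigma * t * \int[leb]_(u in `[t, +oo[) (discount r u * X u w) + B t w.

End processes.

Arguments is_brownian {d T R} P W.
Arguments is_ornstein_uhlenbeck {d T R} P kappa theta psi x0 beta X.

(* Main.v *)
Require Import Defs.
From HB Require Import structures.
From mathcomp Require Import all_boot all_order all_algebra.
From mathcomp Require Import all_classical all_reals all_analysis.
From mathcomp Require Import measurable_realfun.
From mathcomp Require Import ring lra.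

Import Order.TTheory GRing.Theory Num.Theory.
Import numFieldNormedType.Exports.

Local Open Scope classical_set_scope.
Local Open Scope ring_scope.

(* Write Y_t for the integral of pi_v X_v over [t, oo[ and W_s = B_s - B_0.
   Two families of random variables are independent: the past of beta up to t
   together with the bridges W_s - (s/t) W_t, s <= t, and the increments of
   beta after t together with W_t and W_u. The Ornstein-Uhlenbeck equation makes
   X_s (s <= t) a function of the past and X_v (v >= t) a function of X_t and
   the future increments, while
     xi_s = sigma s int_[s,t] pi_v X_v dv + (s/t) xi_t + (W_s - (s/t) W_t).
   Hence conditioning on all xi_s, X_s (s <= t) is conditioning on xi_t and on
   functions of the first family, of which only X_t is relevant for xi_u and
   X_u, these being functions of X_t and of the second family.

   This decomposition rests on Y_s = int_[s,t] + Y_t, which holds when pi X is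
   integrable along the path; otherwise Rintegral gives Y_s = Y_t = 0. Instead
   of estimating moments to show integrability, one observes that it is a tail
   event of the increments of beta, hence of probability 0 or 1, and that the
   argument works in both cases. *)

Set Implicit Arguments.
Unset Strict Implicit.
Unset Printing Implicit Defensive.

(** * Sigma-algebras generated by families of random variables *)

Definition events {d} {T : measurableType d} {R : realType} (F : set (T -> R))
  : set (set T) := <<s sigma_gens F >>.

Definition adapted {d} {T : measurableType d} {R : realType} (F : set (T -> R))
  (f : T -> R) : Prop := measurable_fun [set: g_sigma_algebraType (sigma_gens F)] f.

Definition rvs {d} {T : measurableType d} {R : realType} (F : set (T -> R)) : Prop :=
  forall f, F f -> measurable_fun [set: T] f.

(** Null sets are encoded as a family of random variables, so that completing a sigma-algebra
    amounts to a union of families: the indicator of each measurable null set is a member. *)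
Definition ae_zero {d} {T : measurableType d} {R : realType}
    (P : probability T R) : set (T -> R) :=
  [set f : T -> R | measurable_fun setT f /\ {ae P, forall w, f w = 0}].

Section sigma_families.
Context (d : measure_display) (T : measurableType d) (R : realType).
Implicit Types (F G : set (T -> R)) (f g : T -> R) (A C : set T).

Lemma adapted_preimage F f (D : set R) : adapted F f -> measurable D ->
  events F (f @^-1` D).
Proof. by move=> af mD; rewrite -[_ @^-1` _]setTI; exact: af. Qed.

Lemma adapted_mem F f : F f -> adapted F f.
Proof.
move=> Ff _ D mD; apply: sub_sigma_algebra; exists f => //.
by exists D.
Qed.

Lemma eventsS F G : (forall f, F f -> adapted G f) -> events F `<=` events G.
Proof.
move=> FG; apply: smallest_sub; first exact: smallest_sigma_algebra.
by move=> _ [f Ff] [D mD <-]; apply: FG.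
Qed.

Lemma adaptedS F G f : (forall f, F f -> adapted G f) -> adapted F f -> adapted G f.
Proof. by move=> FG Ff _ D mD; apply: (eventsS FG); exact: Ff. Qed.

Lemma adapted_sub F G f : F `<=` G -> adapted F f -> adapted G f.
Proof. by move=> FG; apply: adaptedS => g /FG; exact: adapted_mem. Qed.

Lemma events_sub F G : F `<=` G -> events F `<=` events G.
Proof. by move=> FG; apply: eventsS => g /FG; exact: adapted_mem. Qed.

Lemma events_measurable F A : rvs F -> events F A -> measurable A.
Proof. by move=> rF; exact: sigma_gens_measurable. Qed.

Lemma adapted_measurable F f : rvs F -> adapted F f -> measurable_fun setT f.
Proof. by move=> rF af _ D mD; apply: (events_measurable rF); exact: af. Qed.

Lemma rvsU F G : rvs F -> rvs G -> rvs (F `|` G).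
Proof. by move=> rF rG f [/rF|/rG]. Qed.

Lemma rvs1 f : measurable_fun setT f -> rvs [set f].
Proof. by move=> mf _ ->. Qed.

Lemma eventsT F : events F setT.
Proof. exact: (@measurableT _ (g_sigma_algebraType (sigma_gens F))). Qed.

Lemma eventsC F A : events F A -> events F (~` A).
Proof. exact: (@measurableC _ (g_sigma_algebraType (sigma_gens F))). Qed.

Lemma eventsI F A C : events F A -> events F C -> events F (A `&` C).
Proof. exact: (@measurableI _ (g_sigma_algebraType (sigma_gens F))). Qed.

(** Together with [events_setI_closed] this presents a join of sigma-algebras as generated by a
    pi-system, the form in which the pi-lambda theorem is applied to it below. *)
Lemma events_setIl_gen F G : events (F `|` G) =
  <<s [set A `&` C | A in events F & C in events G] >>.
Proof.
rewrite eqEsubset; split; apply: smallest_sub => //;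
  try exact: smallest_sigma_algebra.
- move=> _ [f [Ff|Gf]] [D mD <-]; apply: sub_sigma_algebra.
  + exists (setT `&` f @^-1` D); last by exists setT; [exact: eventsT|rewrite setIT].
    by apply: adapted_mem.
  + exists setT; first exact: eventsT.
    by exists (setT `&` f @^-1` D); [apply: adapted_mem|rewrite setTI].
- move=> _ [A FA] [C GC <-]; apply: eventsI.
    by apply: events_sub FA => ?; left.
  by apply: events_sub GC => ?; right.
Qed.

Lemma events_setI_closed F G :
  setI_closed [set A `&` C | A in events F & C in events G].
Proof.
move=> _ _ [A FA] [C GC <-] [A' FA'] [C' GC' <-].
exists (A `&` A'); first exact: eventsI.
by exists (C `&` C'); [exact: eventsI|rewrite setIACA].
Qed.

End sigma_families.

Lemma events1P d (T : measurableType d) (R : realType) (f : T -> R) (A : set T) :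
  events [set f] A -> exists2 D : set R, measurable D & A = f @^-1` D.
Proof.
move=> fA; suff : events [set f] `<=` [set A | exists2 D : set R,
  measurable D & A = f @^-1` D] by exact.
apply: smallest_sub; last first.
  by move=> _ [_ ->] [D mD <-]; exists D => //; rewrite setTI.
split => /=.
- by exists set0; rewrite ?preimage_set0.
- move=> _ [D mD ->]; exists (~` D); first exact: measurableC.
  by rewrite setTD preimage_setC.
- move=> A' /= fA'; pose D n := sval (cid2 (fA' n)).
  have mD n : measurable (D n) by rewrite /D; case: cid2.
  exists (\bigcup_n D n); first exact: bigcupT_measurable.
  rewrite preimage_bigcup; apply: eq_bigcup => // n _.
  by rewrite /D; case: cid2.
Qed.

(** * Independence of families of random variables *)

Section independence.
Context (d : measure_display) (T : measurableType d) (R : realType)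
  (P : probability T R).
Implicit Types (F G : set (T -> R)) (f g : T -> R) (A C : set T).

Lemma indepC F G : indep P F G -> indep P G F.
Proof. by move=> FG A C GA FC; rewrite setIC FG// muleC. Qed.

Lemma indepS F G F' G' : (forall f, F' f -> adapted F f) ->
  (forall f, G' f -> adapted G f) -> indep P F G -> indep P F' G'.
Proof.
by move=> FF GG FG A C FA GC; apply: FG; [exact: (eventsS FF)|exact: (eventsS GG)].
Qed.

Lemma indep_sub F G F' G' : F' `<=` F -> G' `<=` G ->
  indep P F G -> indep P F' G'.
Proof. by move=> FF GG; apply: indepS => f => [/FF|/GG]; exact: adapted_mem. Qed.

(** The events independent of a fixed [A] form a Dynkin system. *)
Lemma pi_lambda_indep (H : set (set T)) A : setI_closed H -> H `<=` measurable ->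
  measurable A -> (forall C, H C -> P (C `&` A) = (P C * P A)%E) ->
  forall C, <<s H >> C -> P (C `&` A) = (P C * P A)%E.
Proof.
move=> HI Hm mA HA C HC.
have PAE : P A = (fine (P A))%:E by rewrite fineK// fin_num_measure.
suff : <<s H >> `<=` [set C | measurable C /\ P (C `&` A) = (P C * P A)%E].
  by move=> /(_ _ HC)[].
apply: lambda_system_subset; [by []| |by move=> D HD; split; [exact: Hm|exact: HA]|by []].
apply/dynkin_lambda_system; split => /=.
- by split => //; rewrite setTI probability_setT mul1e.
- move=> D [mD DA]; split; first exact: measurableC.
  rewrite setIC -setDE measureD ?ltey_eq ?fin_num_measure//.
  rewrite probability_setC// muleBl ?mul1e ?fin_num_adde_defl ?fin_numN ?fin_num_measure//.
  by congr (_ - _)%E; rewrite setIC; exact: DA.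
- move=> D tD HD; have mD n : measurable (D n) by have [] := HD n.
  split; first exact: bigcupT_measurable.
  rewrite setI_bigcupl measure_bigcup//=; last 2 first.
    by move=> n _; exact: measurableI.
    exact: trivIset_setIr.
  rewrite muleC [X in (_ * X)%E]measure_bigcup//= PAE -nneseriesZl//.
  by apply: eq_eseriesr => n _; rewrite -PAE muleC; have [] := HD n.
Qed.

(** On a rectangle with sides from [G] and [H], the side from [H] is split off first, by its
    independence of the join, and then the side from [G]. *)
Lemma indep_joinr F G H : rvs F -> rvs G -> rvs H -> indep P F G ->
  indep P (F `|` G) H -> indep P F (G `|` H).
Proof.
move=> rF rG rH FG FGH A C FA.
rewrite [X in X _ -> _](events_setIl_gen G H) => GHC.
have mA := events_measurable rF FA.
rewrite setIC muleC.
apply: pi_lambda_indep GHC => //; first exact: events_setI_closed.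
  move=> _ [B GB] [D HD <-].
  by apply: measurableI; [exact: (events_measurable rG)|exact: (events_measurable rH)].
move=> _ [B GB] [D HD <-].
have GH : indep P G H by apply: indep_sub FGH => // f; right.
rewrite setIAC FGH//; last first.
  apply: eventsI; first by apply: events_sub GB => ?; right.
  by apply: events_sub FA => ?; left.
by rewrite setIC FG// GH// [(P A * _)%E]muleC muleAC.
Qed.

(** The events of finite subfamilies form a pi-system, since two finite lists can be concatenated,
    and they generate the whole sigma-algebra. This reduces statements on paths to finitely many
    times. *)
Lemma indep_directed (I : eqType) (D : set I) (f : I -> T -> R) G :
  rvs G -> (forall i, D i -> measurable_fun setT (f i)) ->
  (forall s : seq I, (forall i, i \in s -> D i) ->
     indep P [set f i | i in [set i | i \in s]] G) ->
  indep P (f @` D) G.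
Proof.
move=> rG mf H A C FA GC.
have mC := events_measurable rG GC.
pose Pi := [set E | exists2 s : seq I, (forall i, i \in s -> D i) &
  events [set f i | i in [set i | i \in s]] E].
apply: (@pi_lambda_indep Pi) => //.
- move=> E E' [s sD Es] [s' sD' Es']; exists (s ++ s').
    by move=> i; rewrite mem_cat => /orP[/sD|/sD'].
  apply: eventsI; [apply: events_sub Es|apply: events_sub Es'] => _ [i si <-];
    by exists i => //=; rewrite mem_cat si ?orbT.
- move=> E [s sD Es]; apply: events_measurable Es => _ [i si <-].
  by apply: mf; exact: sD.
- by move=> E [s sD Es]; apply: H Es GC.
- apply: sub_sigma_algebra2 FA => _ [g [i Di <-]] [B mB <-].
  exists [:: i]; first by move=> j; rewrite inE => /eqP ->.
  by apply: adapted_mem => //; exists i => //=; rewrite inE.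
Qed.

Lemma ae_zero_rvs : rvs (ae_zero P).
Proof. by move=> f []. Qed.

(** Turns an almost sure formula for [f] into measurability: the error [f - g] is itself a member of
    [ae_zero]. *)
Lemma ae_zero_adapted F f g : adapted F g -> measurable_fun setT g ->
  measurable_fun setT f -> {ae P, forall w, f w = g w} ->
  adapted (F `|` ae_zero P) f.
Proof.
move=> Fg mg mf fg.
have -> : f = g \+ (f \- g) by apply/funext => w /=; rewrite addrC subrK.
apply: measurable_funD; first by apply: adapted_sub Fg => h; left.
apply: adapted_mem; right; split; first exact: measurable_funB.
by apply: filterS fg => w /= ->; rewrite subrr.
Qed.

(** Events of probability 0 or 1 form a sigma-algebra, and a generator, f in [B], is almost sure if
    0 lies in [B] and null otherwise. *)
Lemma ae_zero_events C : events (ae_zero P) C ->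
  measurable C /\ (P C = 0%E \/ P (~` C) = 0%E).
Proof.
move=> HC; split; first exact: (events_measurable ae_zero_rvs).
suff : events (ae_zero P) `<=`
  [set C | measurable C /\ (P C = 0%E \/ P (~` C) = 0%E)] by move=> /(_ _ HC)[].
apply: smallest_sub.
  split => /=.
  - by split => //; left; rewrite measure0.
  - move=> A [mA PA]; rewrite setTD; split; first exact: measurableC.
    by rewrite setCK; case: PA; [right|left].
  - move=> A HA; have mA n : measurable (A n) by have [] := HA n.
    split; first exact: bigcupT_measurable.
    have [[n An]|nA] := pselect (exists n, P (~` A n) = 0%E).
      right; apply: (subset_measure0 _ _ _ An) => //.
      + by apply: measurableC; exact: bigcupT_measurable.
      + exact: measurableC.
      + by apply: subsetC; exact: bigcup_sup.
    left; apply/negligibleP; first exact: bigcupT_measurable.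
    apply: negligible_bigcup => n; apply/negligibleP => //.
    by have [_ [//|An]] := HA n; case: nA; exists n.
move=> _ [f [mf f0]] [B mB <-]; rewrite setTI.
have mfB : measurable (f @^-1` B) by rewrite -[_ @^-1` _]setTI; exact: mf.
split => //.
case: f0 => N [mN N0 /subsetCl fN]; have [B0|nB0] := pselect (B 0).
  right; apply: (subset_measure0 _ mN _ N0); first exact: measurableC.
  by apply: subsetCl => w /fN /= -> .
left; apply: (subset_measure0 mfB mN _ N0).
by move=> w Bfw; apply: contrapT => /fN /= fw0; apply: nB0; rewrite -fw0.
Qed.

Lemma indep_ae_zero F : rvs F -> indep P F (ae_zero P).
Proof.
move=> rF A C FA /ae_zero_events [mC PC].
have mA := events_measurable rF FA.
case: PC => PC.
  rewrite PC mule0; apply: (subset_measure0 _ mC _ PC) => //.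
  exact: measurableI.
have PAC : P (A `&` ~` C) = 0%E.
  apply: (subset_measure0 _ _ _ PC) => //; last exact: measurableC.
  by apply: measurableI => //; exact: measurableC.
have PC1 : P C = 1%E by rewrite -[C]setCK probability_setC ?PC ?sube0//; exact: measurableC.
rewrite PC1 mule1 [RHS](measureDI P mA mC) [X in (X + _)%E](_ : _ = 0%E) ?add0e//.

Qed.

Lemma indep_joinl_ae_zero F G : rvs F -> rvs G -> indep P F G ->
  indep P (F `|` ae_zero P) G.
Proof.
move=> rF rG FG; apply/indepC/indep_joinr => //; [exact: ae_zero_rvs|exact: indepC|].
by apply: indep_ae_zero; exact: rvsU.
Qed.

Lemma indep_ae_zeroU F G : rvs F -> rvs G -> indep P F G ->
  indep P (F `|` ae_zero P) (G `|` ae_zero P).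
Proof.
move=> rF rG FG; have rN := ae_zero_rvs; have := rvsU.
move=> rU; apply: indep_joinl_ae_zero => //; first exact: rU.
by apply/indepC/indep_joinl_ae_zero => //; exact: indepC.
Qed.

(** Repeated regrouping by [indep_joinr]. In the application [F1] and [F2] are the past and the
    future increments of beta, [G1] and [G2] the bridges and the values of B. *)
Lemma indep_cross F1 F2 G1 G2 : rvs F1 -> rvs F2 -> rvs G1 -> rvs G2 ->
  indep P F1 F2 -> indep P G1 G2 -> indep P (F1 `|` F2) (G1 `|` G2) ->
  indep P (F1 `|` G1) (F2 `|` G2).
Proof.
move=> rF1 rF2 rG1 rG2 iF iG iFG.
have i1 : indep P F1 (F2 `|` G2).
  by apply: indep_joinr => //; apply: indep_sub iFG => // f; right.
have i2 : indep P G1 (G2 `|` (F1 `|` F2)).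
  apply: indep_joinr => //; first exact: rvsU.
  exact: indepC.
apply/indepC/indep_joinr => //; [exact: rvsU|exact: indepC|].
by apply/indepC; apply: indep_sub i2 => // f [[]|]; [right; right|left|right; left].
Qed.

End independence.

(** * Conditional probabilities and an abstract Markov lemma *)

(** The sets on which both sides agree form a Dynkin system. Since [f] may change sign, complements
    are treated by subtracting finite quantities. *)
Lemma pi_lambda_integral d (T : measurableType d) (R : realType)
    (mu : {measure set T -> \bar R}) (nu : {finite_measure set T -> \bar R})
    (H : set (set T)) (f : T -> R) : setI_closed H ->
  H `<=` measurable -> H setT -> mu.-integrable setT (EFin \o f) ->
  (forall C, H C -> (\int[mu]_(w in C) (f w)%:E = nu C)%E) ->
  forall C, <<s H >> C -> (\int[mu]_(w in C) (f w)%:E = nu C)%E.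
Proof.
move=> HI Hm HT If HA C HC.
have If' D : measurable D -> mu.-integrable D (EFin \o f).
  by move=> mD; apply: (integrableS measurableT).
suff : <<s H >> `<=` [set C | measurable C /\
   (\int[mu]_(w in C) (f w)%:E = nu C)%E] by move=> /(_ _ HC)[].
apply: lambda_system_subset; [by []| |by move=> D HD; split; [exact: Hm|exact: HA]|by []].
apply/dynkin_lambda_system; split => /=.
- by split => //; exact: HA.
- move=> D [mD DA]; split; first exact: measurableC.
  have mDC := measurableC mD.
  have := HA _ HT; rewrite -(setUv D) integral_setU//; last 2 first.
  + by rewrite setUv; exact: (measurable_int mu).
  + by rewrite disj_set2E setICr.
  rewrite measureU//; last by rewrite setICr.
  rewrite DA => DE; have nuD : nu D \is a fin_num by rewrite fin_num_measure.
  rewrite -[LHS](addeK _ nuD) [X in (X - _)%E]addeC DE.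
  by rewrite [X in (X - _)%E]addeC addeK.
- move=> D tD HD; have mD n : measurable (D n) by have [] := HD n.
  split; first exact: bigcupT_measurable.
  rewrite integral_bigcup//; last by apply: If'; exact: bigcupT_measurable.
  rewrite measure_semi_bigcup//; last exact: bigcupT_measurable.
  by apply: eq_eseriesr => n _; have [] := HD n.
Qed.

Lemma pi_lambda_integral_prob d (T : measurableType d) (R : realType)
    (P : probability T R) (H : set (set T)) (A : set T) (f : T -> R) : setI_closed H ->
  H `<=` measurable -> H setT -> measurable A ->
  P.-integrable setT (EFin \o f) ->
  (forall C, H C -> (\int[P]_(w in C) (f w)%:E = P (A `&` C))%E) ->
  forall C, <<s H >> C -> (\int[P]_(w in C) (f w)%:E = P (A `&` C))%E.
Proof.
move=> HI Hm HT mA If HA C HC.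
have PAoo : (P A < +oo)%E by rewrite ltey_eq fin_num_measure.
rewrite setIC.
apply: (@pi_lambda_integral _ _ _ P (mfrestr mA PAoo) H) => // D /HA ->.
by rewrite setIC.
Qed.

Section conditional_probability.
Context (d : measure_display) (T : measurableType d) (R : realType)
  (P : probability T R).
Implicit Types (F G : set (T -> R)) (f g h : T -> R) (A C : set T).

Lemma integral_indicM C f : measurable C ->
  (\int[P]_(w in C) (f w)%:E = \int[P]_w (\1_C w * f w)%:E)%E.
Proof.
move=> mC; rewrite integral_mkcond; apply: eq_integral => w _.
by rewrite patchE indicE; case: ifP => _; rewrite ?mul1r ?mul0r.
Qed.

Import HBNNSimple.

(* The standard machine: approximate h by simple functions of F. *)
Lemma integralM_sub_sigma F f g h : rvs F ->
  measurable_fun setT f -> measurable_fun setT g -> adapted F h ->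
  (forall w, 0 <= f w) -> (forall w, 0 <= g w) -> (forall w, 0 <= h w) ->
  (forall C, events F C ->
    (\int[P]_(w in C) (f w)%:E = \int[P]_(w in C) (g w)%:E)%E) ->
  (\int[P]_w (h w * f w)%:E = \int[P]_w (h w * g w)%:E)%E.
Proof.
move=> rF mf mg ah f0 g0 h0 fg.
pose S := g_sigma_algebraType (sigma_gens F).
have mh : measurable_fun [set: S] (EFin \o h) by exact/measurable_EFinP.
(* The approximants are built over the sigma-algebra of [F], so their level sets are events of [F],
   on which [f] and [g] have equal integrals. *)
pose h_ := nnsfun_approx (@measurableT _ S) mh.
have Fh n y : events F (h_ n @^-1` [set y]).
  exact: (measurable_funPTI (h_ n) (measurable_set1 y)).
have mh_ n : measurable_fun [set: T] (h_ n).
  by apply: (adapted_measurable rF); exact: measurable_funP.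
have simpleE (k : T -> R) n : measurable_fun setT k -> (forall w, 0 <= k w) ->
   (\int[P]_w (h_ n w * k w)%:E =
    \sum_(y \in range (h_ n)) y%:E * \int[P]_(w in h_ n @^-1` [set y]) (k w)%:E)%E.
  move=> mk k0.
  have mFh y : measurable (h_ n @^-1` [set y] : set T) by exact: (events_measurable rF).
  transitivity (\int[P]_w (\sum_(y \in range (h_ n))
      (y * (\1_(h_ n @^-1` [set y]) w * k w))%:E))%E.
    apply: eq_integral => w _; rewrite fsumEFin//.
    rewrite [X in (X * _)%:E]fimfunE mulr_fsuml.
    by congr (_%:E); apply: eq_fsbigr => y _; rewrite mulrA.
  rewrite ge0_integral_fsum//; last 2 first.
  - move=> y; apply/measurable_EFinP; apply: measurable_funM => //.
    by apply: measurable_funM => //; exact: measurable_indic.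
  - move=> y w _; rewrite lee_fin indicE.
    have [|_] := boolP (w \in _); last by rewrite mul0r mulr0.
    by rewrite inE /preimage/= => <-; rewrite mul1r mulr_ge0.
  apply: eq_fsbigr => y /[!inE] -[w _ <-].
  rewrite (integral_indicM k (mFh _)) -ge0_integralZl//.
  - apply/measurable_EFinP; apply: measurable_funM => //; exact: measurable_indic.
  - by move=> v _; rewrite lee_fin mulr_ge0.
  - by rewrite lee_fin.
have limE (k : T -> R) : measurable_fun setT k -> (forall w, 0 <= k w) ->
   (\int[P]_w (h w * k w)%:E = limn (fun n => \int[P]_w (h_ n w * k w)%:E))%E.
  move=> mk k0; rewrite -monotone_convergence//; last 3 first.
  - by move=> n; apply/measurable_EFinP; exact: measurable_funM.
  - by move=> n w _; rewrite lee_fin mulr_ge0.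
  - move=> w _ m n mn; rewrite lee_fin ler_wpM2r//.
    by have /lefP := nd_nnsfun_approx (@measurableT _ S) mh mn; exact.
  apply: eq_integral => w _; apply/esym/cvg_lim => //.
  rewrite EFinM; under eq_fun do rewrite EFinM.
  apply: cvgeZr => //.
  by apply: (@cvg_nnsfun_approx _ S _ setT) => // v _; rewrite lee_fin.
rewrite !limE//; congr (limn _); apply/funext => n.
by rewrite !simpleE//; apply: eq_fsbigr => y _; rewrite fg.
Qed.

(** Nonnegativity is what [integralM_sub_sigma] asks for. An arbitrary version is cut off to the set
    [D] where it is nonnegative, itself an event of [F]. *)
Lemma ge0_cond_prob A F : measurable A -> rvs F ->
  exists2 f, is_cond_prob P A F f & forall w, 0 <= f w.
Proof.
move=> mA rF; have [af If fA] := cond_probP P mA rF.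
set f := cond_prob P A F in af If fA.
pose D := f @^-1` [set` `[0, +oo[].
have FD : events F D by exact: adapted_preimage.
have mD := events_measurable rF FD.
exists (fun w => \1_D w * f w); last first.
  move=> w; rewrite indicE; have [|_] := boolP (w \in D); last by rewrite mul0r.
  by rewrite inE /D/= /preimage/= in_itv/= andbT mul1r.
split.
- by apply: measurable_funM => //; exact: measurable_indic.
- apply: (le_integrable measurableT _ _ If).
  + apply/measurable_EFinP; apply: measurable_funM; first exact: measurable_indic.
    exact: adapted_measurable af.
  + move=> w _ /=; rewrite lee_fin normrM indicE.
    by case: (w \in D); rewrite ?normr1 ?mul1r// normr0 mul0r.
- move=> C FC; have mC := events_measurable rF FC.
  transitivity (\int[P]_(w in C `&` D) (f w)%:E)%E.
    rewrite (integral_indicM _ mC) (integral_indicM _ (measurableI _ _ mC mD)).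
    by apply: eq_integral => w _; rewrite indicI/= mulrA.
  rewrite fA; last exact: eventsI.
  (* The integral of [f] over the part of [C] outside [D] is at most 0, yet equals a probability; so
     both vanish and the cut-off loses nothing. *)
  have CD0 : (P (A `&` (C `&` ~` D)) = 0)%E.
    apply/eqP; rewrite eq_le measure_ge0 andbT -fA; last by apply: eventsI => //; exact: eventsC.
    rewrite -oppe_ge0 -integralN/=; last first.
      by apply/integrable_add_def/(integrableS measurableT) => //;
        apply: measurableI => //; exact: measurableC.
    apply: integral_ge0 => w [_] /negP; rewrite in_itv/= andbT -ltNge => /ltW.
    by rewrite /= -?EFinN lee_fin oppr_ge0.
  rewrite [RHS](measureDI P (measurableI _ _ mA mC) mD).
  rewrite setIA [X in (_ = X + _)%E](_ : _ = 0%E) ?add0e//.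
  by rewrite setDE -setIA.
Qed.

(** The two versions are comparable on events of [F] only. The comparison is therefore made under
    the image [Q] of [P] on the space carrying just the sigma-algebra of [F], where these are all
    the measurable sets. *)
Lemma is_cond_prob_ae_eq A F f g : rvs F ->
  is_cond_prob P A F f -> is_cond_prob P A F g -> {ae P, forall w, f w = g w}.
Proof.
move=> rF [af If fA] [ag Ig gA].
pose S := g_sigma_algebraType (sigma_gens F).
pose j : T -> S := id.
have mj : measurable_fun setT j.
  by move=> _ C mC; rewrite setTI; exact: (events_measurable rF).
pose J : {mfun T >-> S} := HB.pack j (isMeasurableFun.Build _ _ _ _ j mj).
pose Q : probability S R := distribution P J.
have intQ k C : P.-integrable setT (EFin \o k) -> adapted F k -> events F C ->
    (\int[Q]_(w in C) (k w)%:E = \int[P]_(w in C) (k w)%:E)%E.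
  move=> Ik ak FC; rewrite (@integral_pushforward _ _ _ _ R j mj P C)//.
    exact/measurable_EFinP/measurable_funTS.
  by apply: (integrableS measurableT) => //; exact: (events_measurable rF).
have IQ : Q.-integrable setT (EFin \o f : S -> _).
  apply/integrableP; split; first exact/measurable_EFinP.
  move/integrableP: If => [_]; apply: le_lt_trans.
  rewrite le_eqVlt; apply/orP; left; apply/eqP.
  rewrite [LHS](@ge0_integral_pushforward _ _ _ _ R j mj P setT)//.
  by apply: measurableT_comp => //; exact/measurable_EFinP.
have : ae_eq Q setT (EFin \o f) (EFin \o g).
  apply: (integral_ae_eq measurableT) => //; first exact/measurable_EFinP.
  move=> C _ FC; rewrite /= intQ// intQ//.
  by rewrite fA// gA.
case=> N [mN N0 fgN]; exists N; split => //; first exact: (events_measurable rF).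
by move=> w nfg; apply: fgN => /= /(_ Logic.I)[].
Qed.

(* F1 and (x, F2) are conditionally independent given x. *)
Lemma indep_cond_prob F1 F2 x H q : rvs F1 -> rvs F2 -> indep P F1 F2 ->
  adapted F1 x -> events F1 H -> is_cond_prob P H [set x] q ->
  (forall w, 0 <= q w) -> forall K, events ([set x] `|` F2) K ->
  (\int[P]_(w in K) (q w)%:E = P (H `&` K))%E.
Proof.
move=> rF1 rF2 F12 ax FH [aq Iq qH] q0 K.
rewrite [X in X _ -> _]events_setIl_gen => xK.
have mx := adapted_measurable rF1 ax.
have rx := rvs1 mx.
have mH := events_measurable rF1 FH.
apply: pi_lambda_integral_prob xK => //; first exact: events_setI_closed.
- move=> _ [A xA] [C FC <-].
  by apply: measurableI; [exact: (events_measurable rx)|exact: (events_measurable rF2)].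
- by exists setT; [exact: eventsT|exists setT; [exact: eventsT|rewrite setIT]].
move=> _ [A xA] [C FC <-].
have xF1 : [set x] `<=` adapted F1 by move=> _ ->.
have mA := events_measurable rx xA.
have mC := events_measurable rF2 FC.
have FA := eventsS xF1 xA.
rewrite setIA F12//; last exact: eventsI.
transitivity (\int[P]_w (\1_A w * q w * \1_C w)%:E)%E.
  rewrite integral_indicM; last exact: measurableI.
  by apply: eq_integral => w _; rewrite indicI/=; congr (_%:E); ring.
(* [C] is independent of [F1], to which the factor 1_A q is adapted, so the indicator of [C] may be
   replaced by its mean. *)
transitivity (\int[P]_w (\1_A w * q w * fine (P C))%:E)%E.
  apply: (@integralM_sub_sigma F1 (\1_C) (cst (fine (P C))) (fun w => \1_A w * q w)) => //.
  - apply: measurable_funM; first exact: (@measurable_indic _ (g_sigma_algebraType (sigma_gens F1))).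
    exact: adaptedS aq.
  - by move=> w; rewrite fine_ge0.
  - by move=> w; rewrite mulr_ge0.
  - move=> D FD; have mD := events_measurable rF1 FD.
    rewrite integral_indic//; transitivity (P C * P D)%E.
      by transitivity (P (D `&` C)); [rewrite setIC|rewrite F12// muleC].
    rewrite -integral_cst//; apply: eq_integral => w _ /=.
    by rewrite fineK// fin_num_measure.
under eq_integral do rewrite EFinM.
rewrite ge0_integralZr ?lee_fin ?fine_ge0//; last 2 first.
- apply/measurable_EFinP; apply: measurable_funM; first exact: measurable_indic.
  exact: (adapted_measurable rx).
- by move=> w _; rewrite lee_fin mulr_ge0.
by rewrite -integral_indicM// qH// fineK ?fin_num_measure.
Qed.

(** Let f be a version of P[A | y, x] and q one of P[H | x]. Over the intersection of H from [F1]
    and D from [y], the indicator of H is exchanged for q, then f for the indicator of [A], then q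
    back for that of H. Such rectangles generate the join of [F1] and [y], which contains the events
    of [F]. *)
Lemma cond_prob_markov F1 F2 F x y A : rvs F1 -> rvs F2 -> indep P F1 F2 ->
  adapted F1 x -> adapted ([set x] `|` F2) y -> events ([set x] `|` F2) A ->
  F x -> F y -> (forall f, F f -> adapted (F1 `|` [set y]) f) ->
  {ae P, forall w, cond_prob P A F w = cond_prob P A [set y; x] w}.
Proof.
move=> rF1 rF2 F12 ax ay KA Fx Fy FF.
have rx := rvs1 (adapted_measurable rF1 ax).
have rK := rvsU rx rF2.
have my := adapted_measurable rK ay.
have ry := rvs1 my.
have rF : rvs F by move=> f /FF; apply: adapted_measurable; exact: rvsU.
have ryx : rvs [set y; x] by exact: rvsU.
have mA := events_measurable rK KA.
have [f [af If fA] f0] := ge0_cond_prob mA ryx.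
have yxF : [set y; x] `<=` F by move=> g [->|->].
suff ff : is_cond_prob P A F f.
  have e1 := is_cond_prob_ae_eq rF (cond_probP P mA rF) ff.
  have e2 := is_cond_prob_ae_eq ryx (cond_probP P mA ryx) (And3 af If fA).
  by apply: filterS2 e1 e2 => w -> ->.
split => //; first exact: adapted_sub af.
move=> C FC; have := eventsS FF FC.
rewrite [X in X _ -> _]events_setIl_gen => {FC}.
apply: pi_lambda_integral_prob => //; first exact: events_setI_closed.
- move=> _ [H FH] [D yD <-].
  by apply: measurableI; [exact: (events_measurable rF1)|exact: (events_measurable ry)].
- by exists setT; [exact: eventsT|exists setT; [exact: eventsT|rewrite setIT]].
move=> _ [H FH] [D yD <-].
have mH := events_measurable rF1 FH.
have mD := events_measurable ry yD.
have [q qH q0] := ge0_cond_prob mH rx.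
have qK := indep_cond_prob rF1 rF2 F12 ax FH qH q0.
have [aq Iq _] := qH.
have yK : [set y] `<=` adapted ([set x] `|` F2) by move=> _ ->.
have yxK : [set y; x] `<=` adapted ([set x] `|` F2).
  by move=> _ [->//|->]; apply: adapted_mem; left.
have KD := eventsS yK yD.
have mq := adapted_measurable rx aq.
have mf := adapted_measurable ryx af.
transitivity (\int[P]_w (\1_D w * f w * \1_H w)%:E)%E.
  rewrite integral_indicM; last exact: measurableI.
  by apply: eq_integral => w _; rewrite indicI/=; congr (_%:E); ring.
(* 1_D f is a function of [x] and [F2], on whose events q and 1_H have equal integrals by [qK]. *)
transitivity (\int[P]_w (\1_D w * f w * q w)%:E)%E.
  apply: (@integralM_sub_sigma ([set x] `|` F2) (\1_H) q (fun w => \1_D w * f w)) => //.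
  - apply: measurable_funM; last exact: adaptedS af.
    exact: (@measurable_indic _ (g_sigma_algebraType _)).
  - by move=> w; rewrite mulr_ge0.
  - move=> K KK; have mK := events_measurable rK KK.
    by rewrite integral_indic// qK.
transitivity (\int[P]_w (\1_D w * q w * f w)%:E)%E.
  by apply: eq_integral => w _; rewrite mulrAC.
(* 1_D q is a function of [y] and [x], so the defining property of [f] applies. *)
transitivity (\int[P]_w (\1_D w * q w * \1_A w)%:E)%E.
  apply: (@integralM_sub_sigma [set y; x] f (\1_A) (fun w => \1_D w * q w)) => //.
  - apply: measurable_funM; last by apply: adapted_sub aq => g ->; right.
    apply: (@measurable_indic _ (g_sigma_algebraType _)).
    by apply: events_sub yD => g ->; left.
  - by move=> w; rewrite mulr_ge0.
  - move=> K KK; have mK := events_measurable ryx KK.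
    by rewrite integral_indic// fA.
(* [A] and [D] are events of [x] and [F2], so [qK] also leads back from q to H. *)
rewrite setIA [A `&` H]setIC -setIA -qK; last exact: eventsI.
rewrite integral_indicM; last exact: measurableI.
by apply: eq_integral => w _; rewrite indicI/=; congr (_%:E); ring.
Qed.

End conditional_probability.

(** * Translation invariance of Lebesgue measure *)

Section lebesgue_shift.
Context (R : realType).
Local Notation leb := (@lebesgue_measure R).

(** The translated measure agrees with Lebesgue measure on half-open intervals, which determine
    it. *)
Lemma ge0_integral_shift (f : R -> R) (c : R) :
  measurable_fun setT f -> (forall x, 0 <= f x) ->
  (\int[leb]_x (f (x + c))%:E = \int[leb]_x (f x)%:E)%E.
Proof.
move=> mf f0.
have ms : measurable_fun [set: measurableTypeR R]
    (fun x : measurableTypeR R => x + c : measurableTypeR R).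
  exact: measurable_funD.
pose mu : {measure set (measurableTypeR R) -> \bar R} :=
  pushforward leb (fun x : measurableTypeR R => x + c : measurableTypeR R).
have muE A : measurable A -> leb A = mu ms A.
  apply: lebesgue_measure_unique => _ [[p q] _ <-] /=.
  rewrite /mu /= /pushforward.
  have -> : (fun x : R => x + c) @^-1` `]p, q] = `]p - c, q - c]%classic.
    by apply/seteqP; split => x /=; rewrite !in_itv/= ltrBlDr lerBrDr.
  rewrite !lebesgue_measure_itv/= !lte_fin ltrD2r.
  by case: ifP => // _; rewrite -!EFinB; congr (_%:E); lra.
rewrite [RHS](eq_measure_integral (mu ms)); last by move=> A mA _; exact: muE.
rewrite ge0_integral_pushforward//; first exact/measurable_EFinP.
by move=> y _; rewrite lee_fin.
Qed.

End lebesgue_shift.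

(** * Independent linear combinations of two independent Gaussians *)

Section gaussian.
Context (d : measure_display) (T : measurableType d) (R : realType)
  (P : probability T R).
Local Notation leb := (@lebesgue_measure R).

(* Completing the square in the product of the two centred Gaussian densities. *)
Lemma normal_pdf_rotate (a b z v : R) : 0 < a -> 0 < b ->
  normal_pdf 0 (Num.sqrt a) (v + a / (a + b) * z) *
    normal_pdf 0 (Num.sqrt b) (z - (v + a / (a + b) * z)) =
  expR (- (z ^+ 2 / (2 * (a + b)))) *
  (normal_peak (Num.sqrt a) * normal_peak (Num.sqrt b) *
    expR (- ((a + b) * v ^+ 2 / (2 * (a * b))))).
Proof.
move=> a0 b0; rewrite !normal_pdfE ?gt_eqF ?sqrtr_gt0// /normal_fun.
rewrite !sqr_sqrtr ?ltW//.
rewrite mulrACA -expRD [RHS]mulrCA -expRD; congr (_ * expR _).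
have ? : a + b != 0 by rewrite gt_eqF// addr_gt0.
have ? : a != 0 by rewrite gt_eqF.
have ? : b != 0 by rewrite gt_eqF.
by rewrite -[a *+ 2]mulr_natl -[b *+ 2]mulr_natl; field; apply/and3P.
Qed.

(** The product density and the law of the pair agree on rectangles, by [phiX] and by independence;
    the pi-lambda argument does the rest. *)
Lemma normal_joint_law (X Y : {RV P >-> R}) (sx sy : R) :
  (forall D : set R, measurable D -> P (X @^-1` D) = normal_prob 0 sx D) ->
  (forall D : set R, measurable D -> P (Y @^-1` D) = normal_prob 0 sy D) ->
  indep P [set (X : T -> R)] [set (Y : T -> R)] ->
  forall M : set (R * R), measurable M ->
  P ((fun w => (X w, Y w)) @^-1` M) =
  (\int[leb]_x \int[leb]_y
    (\1_M (x, y) * (normal_pdf 0 sx x * normal_pdf 0 sy y))%:E)%E.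
Proof.
move=> lX lY XY M mM.
have mXY : measurable_fun setT (fun w => (X w, Y w) : measurableTypeR R * measurableTypeR R).
  apply: (@measurable_fun_pair _ _ _ T (measurableTypeR R) (measurableTypeR R)).
    exact: (measurable_funP X).
  exact: (measurable_funP Y).
pose V : {mfun T >-> (measurableTypeR R * measurableTypeR R)%type} :=
  HB.pack (fun w => (X w, Y w) : measurableTypeR R * measurableTypeR R)
  (isMeasurableFun.Build _ _ _ _ _ mXY).
pose phi (z : R * R) : R := normal_pdf 0 sx z.1 * normal_pdf 0 sy z.2.
have mphi : measurable_fun setT phi.
  apply: measurable_funM; apply: measurableT_comp => //; exact: measurable_normal_pdf.
have phi0 z : 0 <= phi z by rewrite mulr_ge0 ?normal_pdf_ge0.
have phiX (A C : set R) : measurable A -> measurable C ->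
    (\int[leb \x leb]_(z in A `*` C) (phi z)%:E =
     normal_prob 0 sx A * normal_prob 0 sy C)%E.
  move=> mA mC; rewrite integral_mkcond fubini_tonelli1; last 2 first.
  - apply/(measurable_restrictT _ _).1; first exact: measurableX.
    exact/measurable_EFinP/measurable_funTS.
  - by move=> z; rewrite patchE; case: ifP => // _; rewrite lee_fin.
  have pdfC x : (\int[leb]_(y in C) (normal_pdf 0 x y)%:E)%E \is a fin_num.
    by rewrite -/(normal_prob 0 x C) fin_num_measure.
  transitivity (\int[leb]_x (((EFin \o normal_pdf 0 sx) \_ A) x *
      (fine (normal_prob 0 sy C))%:E))%E.
    apply: eq_integral => x _; rewrite /fubini_F fineK ?fin_num_measure//.
    rewrite /normal_prob [in RHS]integral_mkcond.
    rewrite !patchE; have [xA|xA] := boolP (x \in A); last first.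
      rewrite mul0e; apply: integral0_eq => y _; rewrite patchE.
      by rewrite in_setX/= (negbTE xA).
    rewrite /= -ge0_integralZl//; last 3 first.
    - apply/(measurable_restrictT _ _).1 => //.
      by apply/measurable_EFinP/measurable_funTS; exact: measurable_normal_pdf.
    - by move=> y _; rewrite patchE; case: ifP => // _; rewrite lee_fin normal_pdf_ge0.
    - by rewrite lee_fin normal_pdf_ge0.
    apply: eq_integral => y _; rewrite !patchE in_setX/= xA/=.
    by case: ifP => _; rewrite ?mule0.
  rewrite ge0_integralZr//; last 3 first.
  - apply/(measurable_restrictT _ _).1 => //.
    by apply/measurable_EFinP/measurable_funTS; exact: measurable_normal_pdf.
  - by move=> y _; rewrite patchE; case: ifP => // _; rewrite lee_fin normal_pdf_ge0.
  - by rewrite lee_fin fine_ge0.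
  by rewrite fineK ?fin_num_measure// -integral_mkcond.
have iphi : (leb \x leb)%E.-integrable setT (EFin \o phi).
  apply/integrableP; split; first exact/measurable_EFinP.
  under eq_integral do rewrite /= ger0_norm//.
  have := phiX _ _ (@measurableT _ R) (@measurableT _ R).
  by rewrite setXTT => ->; rewrite !probability_setT mule1 ltry.
rewrite -[LHS]/(distribution P V M).
rewrite -(@pi_lambda_integral _ _ _ (leb \x leb)%E (distribution P V)
   [set A `*` C | A in measurable & C in measurable] phi) //.
- rewrite integral_mkcond fubini_tonelli1; last 2 first.
  + apply/(measurable_restrictT _ _).1 => //.
    exact/measurable_EFinP/measurable_funTS.
  + by move=> z; rewrite patchE; case: ifP => // _; rewrite lee_fin.
  apply: eq_integral => x _; apply: eq_integral => y _.
  by rewrite patchE indicE; case: ifP => _; rewrite ?mul1r ?mul0r.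
- move=> _ _ [A mA [C mC <-]] [A' mA' [C' mC' <-]].
  exists (A `&` A'); first exact: measurableI.
  by exists (C `&` C'); [exact: measurableI|rewrite setXI].
- by move=> _ [A mA [C mC <-]]; exact: measurableX.
- by exists setT => //; exists setT => //; rewrite setXTT.
- move=> _ [A mA [C mC <-]]; rewrite phiX// -lX// -lY//.
  rewrite -XY; last 2 first.
    exact: (adapted_preimage (adapted_mem _)).
    exact: (adapted_preimage (adapted_mem _)).
  by [].
- by rewrite -measurable_prod_measurableType.
Qed.

(** [a] and [b] are the variances, so the two combinations have covariance ba - ab = 0. In the
    coordinates z = x + y and v = x - a z / (a + b) the joint density factors into K(z) L(v), while
    b x - a y = (a + b) v. *)
Lemma gaussian_indep (X Y : {RV P >-> R}) (a b : R) : 0 < a -> 0 < b ->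
  (forall D : set R, measurable D -> P (X @^-1` D) = normal_prob 0 (Num.sqrt a) D) ->
  (forall D : set R, measurable D -> P (Y @^-1` D) = normal_prob 0 (Num.sqrt b) D) ->
  indep P [set (X : T -> R)] [set (Y : T -> R)] ->
  indep P [set (X \+ Y : T -> R)] [set (fun w => b * X w - a * Y w)].
Proof.
move=> a0 b0 lX lY XY.
pose K (z : R) : R := expR (- (z ^+ 2 / (2 * (a + b)))).
pose L (v : R) : R := normal_peak (Num.sqrt a) * normal_peak (Num.sqrt b) *
    expR (- ((a + b) * v ^+ 2 / (2 * (a * b)))).
pose I C := (\int[leb]_z (\1_C z * K z)%:E)%E.
pose J D := (\int[leb]_v (\1_D ((a + b) * v) * L v)%:E)%E.
have prodE (C D : set R) : measurable C -> measurable D ->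
    P ((X \+ Y) @^-1` C `&` (fun w => b * X w - a * Y w) @^-1` D) = (I C * J D)%E.
  move=> mC mD.
  pose M : set (R * R) := [set z | C (z.1 + z.2) /\ D (b * z.1 - a * z.2)].
  have mM : measurable M.
    have m1 : measurable_fun setT (fun z : R * R => z.1 + z.2).
      exact: measurable_funD.
    have m2 : measurable_fun setT (fun z : R * R => b * z.1 - a * z.2).
      by apply: measurable_funB; apply: measurable_funM.
    have := measurableI _ _ (m1 measurableT C mC) (m2 measurableT D mD).
    by rewrite !setTI.
  rewrite -[LHS]/(P ((fun w => (X w, Y w)) @^-1` M)) (normal_joint_law lX lY XY mM).
  pose g (x z : R) : R := \1_C z * \1_D ((a + b) * x - a * z) *
     (normal_pdf 0 (Num.sqrt a) x * normal_pdf 0 (Num.sqrt b) (z - x)).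
  have mg : measurable_fun setT (fun p : R * R => g p.1 p.2).
    apply: measurable_funM; apply: measurable_funM.
    - by apply: measurableT_comp => //; exact: measurable_indic.
    - have m3 : measurable_fun setT (fun p : R * R => (a + b) * p.1 - a * p.2).
        by apply: measurable_funB; apply: measurable_funM.
      exact: (measurableT_comp (@measurable_indic _ _ R setT D mD) m3).
    - by apply: measurableT_comp => //; exact: measurable_normal_pdf.
    - have m3 : measurable_fun setT (fun p : R * R => p.2 - p.1).
        exact: measurable_funB.
      exact: (measurableT_comp (measurable_normal_pdf 0 (Num.sqrt b)) m3).
  have g0 x z : 0 <= g x z by rewrite !mulr_ge0 ?normal_pdf_ge0.
  (* Substitution y = z - x at fixed x. *)
  transitivity (\int[leb]_x \int[leb]_z (g x z)%:E)%E.
    apply: eq_integral => x _.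
    rewrite -(ge0_integral_shift x); last 2 first.
      exact: (measurableT_comp mg (pair1_measurable x)).
      by [].
    apply: eq_integral => y _; congr (_%:E).
    rewrite /g addrK; have -> : (a + b) * x - a * (y + x) = b * x - a * y by ring.
    congr (_ * _); rewrite [y + x]addrC !indicE -natrM mulnb.
    congr (nat_of_bool _)%:R; apply/idP/andP => [/set_mem[/= ? ?]|[/set_mem ? /set_mem ?]].
      by split; exact/mem_set.
    exact/mem_set.
  rewrite (@fubini_tonelli _ _ _ _ R leb leb (fun p => (g p.1 p.2)%:E)); last 2 first.
    exact/measurable_EFinP.
    by move=> p; rewrite lee_fin.
  (* Substitution x = v + a z / (a + b) at fixed z, after which [normal_pdf_rotate] separates the
     variables. *)
  transitivity (\int[leb]_z \int[leb]_v ((\1_C z * K z)%:E * (\1_D ((a + b) * v) * L v)%:E))%E.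
    apply: eq_integral => z _.
    rewrite -(ge0_integral_shift (a / (a + b) * z)); last 2 first.
      exact: (measurableT_comp mg (pair2_measurable z)).
      by [].
    apply: eq_integral => v _; rewrite -EFinM; congr (_%:E).
    rewrite /g /= normal_pdf_rotate// -/(K z) -/(L v).
    have -> : (a + b) * (v + a / (a + b) * z) - a * z = (a + b) * v.
      by field; rewrite gt_eqF// addr_gt0.
    ring.
  have mI : measurable_fun setT (fun z : R => \1_C z * K z).
    apply: measurable_funM; first exact: measurable_indic.
    apply: measurableT_comp => //; apply: measurableT_comp => //.
    by apply: measurable_funM.
  have mJ : measurable_fun setT (fun v : R => \1_D ((a + b) * v) * L v).
    apply: measurable_funM.
      have m3 : measurable_fun setT (fun v : R => (a + b) * v).
        exact: measurable_funM.
      exact: (measurableT_comp (@measurable_indic _ _ R setT D mD) m3).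
    apply: measurable_funM => //; apply: measurableT_comp => //.
    apply: measurableT_comp => //; apply: measurable_funM => //.
    exact: measurable_funM.
  have I0 z : 0 <= \1_C z * K z by rewrite mulr_ge0 ?expR_ge0.
  have J0 v : 0 <= \1_D ((a + b) * v) * L v.
    by rewrite !mulr_ge0 ?expR_ge0 ?normal_peak_ge0.
  rewrite /I -ge0_integralZr//; last 3 first.
  - exact/measurable_EFinP.
  - by move=> z _; rewrite lee_fin.
  - by apply: integral_ge0 => v _; rewrite lee_fin.
  apply: eq_integral => z _; rewrite /J -ge0_integralZl//.
  - exact/measurable_EFinP.
  - by move=> v _; rewrite lee_fin.
  - by rewrite lee_fin.
(* [K] and [L] are not normalised one by one; that their integrals have product 1 suffices to
   regroup the factors. *)
have PT : (I [set: R] * J [set: R] = 1)%E.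
  rewrite -prodE// !preimage_setT setTI; exact: probability_setT.
move=> _ _ /events1P[C mC ->] /events1P[D mD ->].
rewrite prodE//.
rewrite -[X in (P X * _)%E]setIT -[X in (_ * P X)%E]setTI.
rewrite -[X in (P (_ `&` X) * _)%E](preimage_setT (fun w => b * X w - a * Y w)).
rewrite -[X in (_ * P (X `&` _))%E](preimage_setT (X \+ Y)).
rewrite !prodE//.
by rewrite [(I C * J [set: R])%E]muleC muleACA [(J [set: R] * _)%E]muleC PT mul1e.
Qed.

End gaussian.

(** * Brownian motion: independence of future increments and of bridges *)

Section brownian.
Context (d : measure_display) (T : measurableType d) (R : realType)
  (P : probability T R) (W : R -> {RV P >-> R}) (hW : is_brownian P W).
Implicit Types (s t u v : R).

Let past t := [set (W s : T -> R) | s in `[0, t]].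

Lemma rvs_image (I : Type) (D : set I) (f : I -> T -> R) :
  (forall i, D i -> measurable_fun setT (f i)) -> rvs [set f i | i in D].
Proof. by move=> mf _ [i Di <-]; exact: mf. Qed.

Let rvs_past t : rvs (past t).
Proof. by apply: rvs_image => s _; exact: measurable_funP. Qed.

Let rvs_incr (D : set R) t : rvs [set (fun w => W v w - W t w) | v in D].
Proof. by apply: rvs_image => v _; exact: measurable_funB. Qed.

Let past_mem s t : 0 <= s -> s <= t -> adapted (past t) (W s).
Proof. by move=> s0 st; apply: adapted_mem; exists s => //=; rewrite in_itv/= s0. Qed.

Let pastS s t : s <= t -> past s `<=` past t.
Proof.
move=> st _ [r /= + <-]; rewrite in_itv/= => /andP[r0 rs]; exists r => //=.
by rewrite in_itv/= r0 (le_trans rs).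
Qed.

(** Induction along the list. The past up to [t] and the increment from [t] to the first time [m]
    both lie in the past up to [m], of which the later increments are independent by induction. *)
Lemma brownian_path_indep t (l : seq R) : 0 <= t -> path <=%R t l ->
  indep P (past t) [set (fun w => W v w - W t w) | v in [set v | v \in l]].
Proof.
have [_ _ hind _] := hW.
elim: l t => [|m l IH] t t0 /=.
  (* The empty family is embedded in [ae_zero P], which is independent of everything. *)
  move=> _; apply: (@indepS _ _ _ _ (past t) (ae_zero P)).
  - by move=> f; exact: adapted_mem.
  - by move=> f [].
  - exact: indep_ae_zero.
move=> /andP[tm ml]; have m0 := le_trans t0 tm.
have pm : past t `<=` past m by exact: pastS.
have ind : indep P (past t) ([set (fun w => W m w - W t w)] `|`
    [set (fun w => W v w - W m w) | v in [set v | v \in l]]).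
  apply: indep_joinr => //.
  - by apply: rvs1; exact: measurable_funB.
  - exact: hind.
  - apply: indepS (IH m m0 ml) => [f [/pm|->]|f]; try exact: adapted_mem.
    by apply: measurable_funB; exact: past_mem.
apply: indepS ind => // [f|_ [v /= + <-]]; first exact: adapted_mem.
rewrite inE => /predU1P[->|vl]; first by apply: adapted_mem; left.
have -> : (fun w => W v w - W t w) =
  (fun w => W v w - W m w) \+ (fun w => W m w - W t w).
  by apply/funext => w /=; rewrite addrA subrK.
by apply: measurable_funD; apply: adapted_mem; [right; exists v|left].
Qed.

Lemma brownian_future_indep t : 0 <= t ->
  indep P (past t) [set (fun w => W v w - W t w) | v in `[t, +oo[].
Proof.
move=> t0; apply: indepC; apply: indep_directed => //.
  by move=> v _; exact: measurable_funB.
move=> l lt; apply: indepC.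
have slt : path <=%R t (sort <=%R l).
  rewrite path_min_sorted; first exact: sort_le_sorted.
  by apply/allP => v; rewrite mem_sort => /lt; rewrite /= in_itv/= andbT.
apply: indep_sub (brownian_path_indep t0 slt) => // _ [v vl <-].
by exists v => //=; rewrite mem_sort.
Qed.

(** Subtracting W_0, which vanishes only almost surely, makes the identities below hold at every
    outcome. *)
Let W0 s : T -> R := fun w => W s w - W 0 w.
(** Value at time [r] of the Brownian bridge on [0, s]. *)
Let bridge r s : T -> R := fun w => W0 r w - r / s * W0 s w.

Let mW0 s : measurable_fun setT (W0 s).
Proof. exact: measurable_funB. Qed.

Let mbridge r s : measurable_fun setT (bridge r s).
Proof. by apply: measurable_funB => //; exact: measurable_funM. Qed.

Let past_W0 s t : 0 <= s -> s <= t -> adapted (past t) (W0 s).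
Proof.
move=> s0 st; apply: measurable_funB; apply: past_mem => //.
exact: le_trans st.
Qed.

Let past_bridge r s t : 0 <= r -> r <= s -> s <= t -> adapted (past t) (bridge r s).
Proof.
move=> r0 rs st; apply: measurable_funB; first by apply: past_W0 => //; exact: le_trans st.
by apply: measurable_funM => //; apply: past_W0 => //; exact: le_trans rs.
Qed.

(** The increments X over [0, s] and Y over [s, t] have variances s and t - s; X + Y is [W0 t], and
    (t - s) X - s Y is t times the bridge. This is [gaussian_indep] with a = s and b = t - s. *)
Lemma brownian_bridge2_indep s t : 0 < s -> s < t ->
  indep P [set W0 t] [set bridge s t].
Proof.
move=> s0 st; have t0 := lt_trans s0 st.
have [_ _ hind hnorm] := hW.
pose X : {RV P >-> R} := HB.pack (W0 s) (isMeasurableFun.Build _ _ _ _ _ (mW0 s)).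
pose Y : {RV P >-> R} := HB.pack (fun w => W t w - W s w)
  (isMeasurableFun.Build _ _ _ _ _ (measurable_funB (measurable_funP (W t)) (measurable_funP (W s)))).
have XY : indep P [set (X : T -> R)] [set (Y : T -> R)].
  apply: indepS (hind s t (ltW s0) (ltW st)) => [_ ->|f]; last exact: adapted_mem.
  exact: past_W0 (ltW s0) _.
have lX (D : set R) : measurable D -> P (X @^-1` D) = normal_prob 0 (Num.sqrt s) D.
  by move=> mD; rewrite -[in RHS](subr0 s); exact: hnorm.
have lY (D : set R) : measurable D -> P (Y @^-1` D) = normal_prob 0 (Num.sqrt (t - s)) D.
  by move=> mD; exact: hnorm (ltW s0) st _ mD.
have ts0 : 0 < t - s by rewrite subr_gt0.
apply: indepS (gaussian_indep s0 ts0 lX lY XY) => _ ->.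
  have -> : W0 t = X \+ Y by apply/funext => w; rewrite /= /W0; ring.
  exact: adapted_mem.
have -> : bridge s t = (fun w => t^-1 * ((t - s) * X w - s * Y w)).
  by apply/funext => w; rewrite /= /bridge /W0; field; rewrite gt_eqF.
by apply: measurable_funM => //; exact: adapted_mem.
Qed.

(** Induction on the last time [m]. The bridges on [0, m] are independent of [W0 m] and of the
    increment from [m] to [s], jointly; [W0 s] and [bridge m s] are functions of these two and
    independent of each other. Finally [bridge r s] is [bridge r m] plus r/m times [bridge m s]. *)
Lemma brownian_bridge_path_indep (l : seq R) s : 0 < s ->
  sorted <=%R l -> all (fun r => 0 < r <= s) l ->
  indep P [set bridge r s | r in [set r | r \in l]] [set W0 s].
Proof.
elim/last_ind: l s => [|l m IH] s s0.
  move=> _ _; apply: (@indepS _ _ _ _ (ae_zero P) [set W0 s]).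
  - by move=> f [].
  - by move=> f; exact: adapted_mem.
  - by apply: indepC; apply: indep_ae_zero; exact: rvs1.
rewrite all_rcons => slm /andP[/andP[m0 ms] ls].
have [_ _ hind _] := hW.
move: slm; rewrite sorted_pairwise; last exact: le_trans.
rewrite pairwise_rcons -sorted_pairwise; last exact: le_trans.
move=> /andP[/allP lem sl].
have lm : all (fun r => 0 < r <= m) l.
  by apply/allP => r rl; have /andP[-> _] := allP ls _ rl; exact: lem.
(* The bridge on [0, m] vanishes at [m], so this time can be included in the induction
   hypothesis. *)
have mm : [set bridge r m | r in [set r | r \in rcons l m]] `<=`
    adapted [set bridge r m | r in [set r | r \in l]].
  move=> _ [r /= + <-]; rewrite mem_rcons inE => /predU1P[->|rl].
    have -> : bridge m m = cst 0.
      by apply/funext => w; rewrite /bridge divff ?gt_eqF// mul1r subrr.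
    exact: measurable_cst.
  by apply: adapted_mem; exists r.
have IHm := indepS mm (fun f => @adapted_mem _ _ _ _ f) (IH m m0 sl lm).
move: ms; rewrite le_eqVlt => /predU1P[<- //|ms].
set Bm := [set bridge r m | r in [set r | r \in rcons l m]] in mm IHm *.
have rBm : rvs Bm by exact: rvs_image.
have lm' r : r \in rcons l m -> 0 < r <= m.
  by rewrite mem_rcons inE => /predU1P[->|/(allP lm)//]; rewrite m0 lexx.
have Bm_past f : Bm f -> adapted (past m) f.
  by move=> [r /lm' /andP[r0 rm] <-]; apply: past_bridge => //; exact: ltW.
pose inc : T -> R := fun w => W s w - W m w.
have minc : measurable_fun setT inc by exact: measurable_funB.
have i1 : indep P Bm ([set W0 m] `|` [set inc]).
  apply: indep_joinr => //; [exact: rvs1|exact: rvs1|].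
  apply: indepS (hind m s (ltW m0) (ltW ms)) => [f [/Bm_past//|->]|f].
    by apply: past_W0 => //; exact: ltW.
  exact: adapted_mem.
have aW0s : adapted ([set W0 m] `|` [set inc]) (W0 s).
  have -> : W0 s = W0 m \+ inc by apply/funext => w; rewrite /W0 /inc /=; ring.
  by apply: measurable_funD; apply: adapted_mem; [left|right].
have ams : adapted ([set W0 m] `|` [set inc]) (bridge m s).
  apply: measurable_funB; first by apply: adapted_mem; left.
  exact: measurable_funM.
have i2 : indep P [set W0 s] ([set bridge m s] `|` Bm).
  apply: indep_joinr => //; [exact: rvs1|exact: rvs1| |].
    exact: brownian_bridge2_indep.
  by apply: indepC; apply: indepS i1 => [f|f [->|->]] //; exact: adapted_mem.
apply: indepC; apply: indepS i2 => [f|_ [r rl <-]]; first exact: adapted_mem.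
have -> : bridge r s = bridge r m \+ (fun w => r / m * bridge m s w).
  apply/funext => w; rewrite /bridge /=; field.
  by rewrite !gt_eqF.
apply: measurable_funD; first by apply: adapted_mem; right; exists r.
by apply: measurable_funM => //; apply: adapted_mem; left.
Qed.

(** The increment from [t] to [u] is independent of the bridges and [W0 t] jointly, and brings in
    [W0 u]. *)
Lemma brownian_bridge_indep t u : 0 < t -> t <= u ->
  indep P [set (fun w => W0 s w - s / t * W0 t w) | s in `]0, t]] [set W0 t; W0 u].
Proof.
move=> t0 tu; have [_ _ hind _] := hW.
have i1 : indep P [set bridge s t | s in `]0, t]] [set W0 t].
  apply: indep_directed => //; first exact: rvs1.
  move=> l lt.
  have alt : all (fun r => 0 < r <= t) (sort <=%R l).
    by apply/allP => v; rewrite mem_sort => /lt; rewrite /= in_itv/=.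
  apply: indep_sub (brownian_bridge_path_indep t0 (sort_le_sorted l) alt) => // _ [v vl <-].
  by exists v => //=; rewrite mem_sort.
have i2 : indep P [set bridge s t | s in `]0, t]]
    ([set W0 t] `|` [set (fun w => W u w - W t w)]).
  apply: indep_joinr => //; [exact: rvs_image|exact: rvs1| |].
    by apply: rvs1; exact: measurable_funB.
  apply: indepS (hind t u (ltW t0) tu) => [f [[r /= + <-]|->]|f].
  - by rewrite in_itv/= => /andP[r0 rt]; apply: past_bridge => //; exact: ltW.
  - by apply: past_W0 => //; exact: ltW.
  - exact: adapted_mem.
apply: indepS i2 => [f|f [->|->]]; try exact: adapted_mem; first by apply: adapted_mem; left.
have -> : W0 u = W0 t \+ (fun w => W u w - W t w) by apply/funext => w; rewrite /W0 /=; ring.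
by apply: measurable_funD; apply: adapted_mem; [left|right].
Qed.

End brownian.

(** * Joint measurability of continuous processes and of their path integrals *)

Section caratheodory.
Context (d : measure_display) (S : measurableType d) (R : realType).
Local Notation leb := (@lebesgue_measure R).
Variables (W : R -> S -> R) (a : R).
Hypothesis mW : forall t, a <= t -> measurable_fun setT (W t).
Hypothesis cW : forall w, {within `[a, +oo[, continuous (fun t => W t w)}.

(** Rounds down to the mesh 1/(n+1) counted from [a]. Truncation sends negative numbers to 0, so
    times before [a] go to [a]. *)
Let grid (n : nat) (s : R) : R := a + (Num.truncn ((s - a) * n.+1%:R))%:R / n.+1%:R.

Lemma measurable_truncn_level (k : nat) : measurable [set x : R | Num.truncn x = k].
Proof.
case: k => [|k].
  rewrite (_ : [set _ | _] = `]-oo, 1[%classic)//.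
  apply/seteqP; split=> x /=; rewrite in_itv/= -(truncn_le_nat x 0) leqn0.
    by move=> ->.
  by move/eqP.
rewrite (_ : [set _ | _] = `[k.+1%:R, k.+2%:R[%classic)//.
apply/seteqP; split=> x /=; rewrite in_itv/= -truncn_gt_nat -truncn_le_nat -eqn_leq.
  by move=> ->.
by move/eqP => ->.
Qed.

Lemma measurable_grid (n : nat) :
  measurable_fun setT (fun p : measurableTypeR R * S => W (grid n p.1) p.2).
Proof.
move=> _ B mB; rewrite setTI.
pose A k := [set s : R | Num.truncn ((s - a) * n.+1%:R) = k].
have mA k : measurable (A k).
  have mf : measurable_fun setT (fun s : R => (s - a) * n.+1%:R).
    by apply: measurable_funM => //; exact: measurable_funB.
  by have := mf measurableT _ (measurable_truncn_level k); rewrite setTI.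
rewrite (_ : _ @^-1` _ = \bigcup_k (A k `*` W (a + k%:R / n.+1%:R) @^-1` B)).
  apply: bigcupT_measurable => k; apply: measurableX; first exact: mA.
  have ak : a <= a + k%:R / n.+1%:R by rewrite lerDl divr_ge0.
  by have := mW ak measurableT mB; rewrite setTI.
apply/seteqP; split=> [[s w] /= WB|[s w] [k _ [/= sk WB]]].
  by exists (Num.truncn ((s - a) * n.+1%:R)).
by rewrite /preimage/= /grid sk.
Qed.

Lemma grid_cvg s w :
  (fun n => W (grid n s) w) @ \oo --> W (Num.max a s) w.
Proof.
have /subspace_continuousP/(_ (Num.max a s)) := @cW w.
rewrite /= in_itv/= andbT le_max lexx => /(_ isT) /cvgrPdist_lt cWs.
apply/cvgrPdist_lt => e /cWs [r /= r0 Wr].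
near=> n; apply: Wr; last by rewrite /= in_itv/= andbT lerDl divr_ge0.
rewrite /ball_/= /grid.
have n0 : 0 < n.+1%:R :> R by rewrite ltr0n.
have nr : n.+1%:R^-1 < r by near: n; exact: near_infty_natSinv_lt (PosNum r0).
apply: lt_trans nr; have [sa|sa] := leP s a.
  have /eqP -> : Num.truncn ((s - a) * n.+1%:R) == 0%N.
    rewrite -leqn0 truncn_le_nat (le_lt_trans _ ltr01)// mulr_le0_ge0//.
    by rewrite subr_le0.
  by rewrite mul0r addr0 subrr normr0 invr_gt0.
have /truncn_itv : 0 <= (s - a) * n.+1%:R by rewrite mulr_ge0// subr_ge0 ltW.
set k := Num.truncn _ => /andP[k1 k2].
rewrite (_ : s - (a + _) = ((s - a) * n.+1%:R - k%:R) / n.+1%:R); last first.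
  by field; rewrite gt_eqF.
rewrite normrM [`|_^-1|]gtr0_norm ?invr_gt0// -[ltRHS]mul1r ltr_pM2r ?invr_gt0//.
rewrite ger0_norm ?subr_ge0// ltrBlDl.
by rewrite natr1.
Unshelve. all: by end_near. Qed.

(** Limit of the grid processes, which are piecewise constant in time. The maximum with [a] extends
    to the whole line a process controlled from [a] on only. *)
Lemma measurable_caratheodory :
  measurable_fun setT (fun p : measurableTypeR R * S => W (Num.max a p.1) p.2).
Proof.
apply: (@measurable_fun_cvg _ _ _ setT (fun n p => W (grid n p.1) p.2)).
  exact: measurable_grid.
by move=> [s w] _; exact: grid_cvg.
Qed.

Variables (D : set R) (g : R -> R).
Hypothesis mD : measurable D.
Hypothesis Da : D `<=` `[a, +oo[.
Hypothesis mg : measurable_fun D g.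

Let f (p : measurableTypeR R * S) : R := (g \_ D) p.1 * W (Num.max a p.1) p.2.

Let mf : measurable_fun setT f.
Proof.
apply: measurable_funM; last exact: measurable_caratheodory.
have mg' : measurable_fun [set: measurableTypeR R] (g \_ D).
  exact: ((measurable_restrictT g mD).1 mg).
exact: (measurableT_comp mg' (@measurable_fst _ _ _ _)).
Qed.

Let fE w (s : R) : ((fun s => g s * W s w) \_ D) s = f (s, w).
Proof.
rewrite /f !patchE /=; case: ifPn => [|_]; last by rewrite mul0r.
rewrite inE => /Da; rewrite /= in_itv/= andbT => /max_idPr as_.
by rewrite as_.
Qed.

(** The sigma-algebra on [S] is arbitrary: for the one generated by a family, this makes the
    integral adapted once the process is adapted at all times from [a] on. *)
Lemma measurable_Rintegral_process :
  measurable_fun setT (fun w => \int[leb]_(s in D) (g s * W s w)).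
Proof.
(* No integrability is assumed: Tonelli applies to the positive and negative parts, and [fine] of
   their difference is measurable even where it takes its default value. *)
rewrite (_ : (fun w => _) = fun w => fine (\int[leb]_s ((EFin \o f)^\+%E (s, w)) -
    \int[leb]_s ((EFin \o f)^\-%E (s, w)))%E).
  apply: measurableT_comp; first exact: fine_measurable.
  have mEf : measurable_fun setT (EFin \o f) by exact/measurable_EFinP.
  apply: emeasurable_funB.
    exact: (measurable_fun_fubini_tonelli_G ((EFin \o f)^\+)%E
      (measurable_funepos mEf) (funepos_ge0 _)).
  exact: (measurable_fun_fubini_tonelli_G ((EFin \o f)^\-)%E
      (measurable_funeneg mEf) (funeneg_ge0 _)).
apply/funext => w; rewrite Rintegral_mkcond /Rintegral integralE.
by congr (fine (_ - _)); apply: eq_integral => s _;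
  rewrite ?funeposE ?funenegE /= fE.
Qed.

Lemma measurable_integral_norm_process :
  measurable_fun setT (fun w => \int[leb]_(s in D) `|(g s * W s w)%:E|)%E.
Proof.
rewrite (_ : (fun w => _) = fun w => \int[leb]_s (abse \o (EFin \o f)) (s, w))%E.
  have mEf : measurable_fun setT (abse \o (EFin \o f)).
    by apply: measurableT_comp => //; exact/measurable_EFinP.
  exact: (measurable_fun_fubini_tonelli_G _ mEf (fun x => abse_ge0 _)).
apply/funext => w; rewrite integral_mkcond; apply: eq_integral => s _.
rewrite /= -fE !patchE; case: ifP => //; by rewrite normr0.
Qed.

End caratheodory.

(** * Integrals along a path and the Ornstein-Uhlenbeck equation *)

Section paths.
Context (R : realType).
Local Notation leb := (@lebesgue_measure R).
Implicit Types (f x b : R -> R).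

(** Stopping does not increase the distance between two times. *)
Lemma within_continuous_stop f (t : R) : 0 <= t ->
  {within `[0, +oo[, continuous f} ->
  {within `[0, +oo[, continuous (fun s => f (Num.min s t))}.
Proof.
move=> t0 cf; apply/subspace_continuousP => x; rewrite /= in_itv/= andbT => x0.
have /subspace_continuousP/(_ (Num.min x t)) := cf.
rewrite /= in_itv/= andbT le_min x0 t0 => /(_ isT) /cvgrPdist_lt cfx.
apply/cvgrPdist_lt => e /cfx [r /= r0 Wr].
exists r => // z; rewrite /ball_/= => zr; rewrite /= in_itv/= andbT => z0.
apply: Wr; last by rewrite /= in_itv/= andbT le_min z0.
apply: le_lt_trans zr; rewrite /Num.min.
have := ler_norm (x - z); have := ler_norm (z - x); rewrite distrC => h1 h2.
by rewrite ler_norml; case: ltP => xt; case: ltP => zt; apply/andP; split; lra.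
Qed.

(** The positive or the negative part has infinite integral, so the extended difference is infinite
    and [fine] returns 0. This settles the value of the dividend integral on divergent paths. *)
Lemma Rintegral_not_integrable (D : set R) f : measurable D ->
  measurable_fun D f -> ~ leb.-integrable D (EFin \o f) ->
  \int[leb]_(s in D) f s = 0.
Proof.
move=> mD mf nf; rewrite /Rintegral integralE.
have mp : measurable_fun D (EFin \o f)^\+%E.
  by apply: measurable_funepos; exact/measurable_EFinP.
have mn : measurable_fun D (EFin \o f)^\-%E.
  by apply: measurable_funeneg; exact/measurable_EFinP.
have [pfin|pinf] := ltP (\int[leb]_(s in D) (EFin \o f)^\+%E s)%E +oo%E.
  have [nfin|ninf] := ltP (\int[leb]_(s in D) (EFin \o f)^\-%E s)%E +oo%E.
    exfalso; apply: nf; apply/integrableP; split; first exact/measurable_EFinP.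
    have -> : (\int[leb]_(s in D) `|(EFin \o f) s| =
      \int[leb]_(s in D) (EFin \o f)^\+ s + \int[leb]_(s in D) (EFin \o f)^\- s)%E.
      rewrite -ge0_integralD//; apply: eq_integral => s _.
      by rewrite -[LHS]/((abse \o (EFin \o f)) s) fune_abse.
    by rewrite lte_add_pinfty.
  move: ninf; rewrite leye_eq => /eqP ->.
  by case: (\int[leb]_(x in D) _)%E pfin.
move: pinf; rewrite leye_eq => /eqP ->.
by case: (\int[leb]_(x in D) _)%E.
Qed.

Lemma within_continuous_integrable f (s t : R) : 0 <= s ->
  {within `[0, +oo[, continuous f} -> leb.-integrable `[s, t] (EFin \o f).
Proof.
move=> s0 cf; apply: continuous_compact_integrable; first exact: segment_compact.
apply: continuous_subspaceW cf => r /=; rewrite !in_itv/= andbT => /andP[sr _].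
exact: le_trans sr.
Qed.

Lemma within_continuous_measurable f :
  {within `[0, +oo[, continuous f} -> measurable_fun (`[0, +oo[ : set R) f.
Proof. by move=> cf; apply: subspace_continuous_measurable_fun. Qed.

Lemma within_continuous_in f (s : R) :
  {within `[0, +oo[, continuous f} -> 0 < s -> {for s, continuous f}.
Proof.
by move=> /continuous_within_itvcyP[cf _] s0; apply: cf; rewrite in_itv/= s0.
Qed.

Lemma Rintegral_itvcy_split f (s t : R) : 0 <= s -> s <= t ->
  leb.-integrable `[0, +oo[ (EFin \o f) ->
  \int[leb]_(r in `[s, +oo[) f r =
  \int[leb]_(r in `[s, t]) f r + \int[leb]_(r in `[t, +oo[) f r.
Proof.
move=> s0 st If.
have sub (D : set R) : D `<=` `[0, +oo[ -> measurable D -> leb.-integrable D (EFin \o f).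
  by move=> D0 mD; exact: integrableS If.
have e : `[s, +oo[%classic = `[s, t[ `|` `[t, +oo[ :> set R.
  apply/seteqP; split => r /=; rewrite !in_itv/= !andbT.
    by move=> ->; have [rt|] := ltP r t; [left|right].
  by case=> [/andP[]//|]; exact: le_trans.
rewrite e Rintegral_setU//; last 2 first.
- rewrite -e; apply: sub => // r /=; rewrite !in_itv/= !andbT; exact: le_trans.
- rewrite disj_set2E; apply/eqP/seteqP; split => r //=; rewrite !in_itv/= andbT.
  by move=> [/andP[_ rt]]; rewrite leNgt rt.
congr (_ + _); apply: Rintegral_itv_bndo_bndc.
apply: sub => // r /=; rewrite !in_itv/= andbT => /andP[sr _].
exact: le_trans sr.
Qed.

(** A continuous function is integrable on the compact [0, t], so only the tail matters. *)
Lemma integrable_itvcy_tail f (t : R) : 0 <= t ->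
  {within `[0, +oo[, continuous f} ->
  leb.-integrable `[0, +oo[ (EFin \o f) <-> leb.-integrable `[t, +oo[ (EFin \o f).
Proof.
move=> t0 cf; split => If.
  apply: integrableS If => // r /=; rewrite !in_itv/= !andbT; exact: le_trans.
have e : `[0, +oo[%classic = `[0, t] `|` `]t, +oo[ :> set R.
  apply/seteqP; split => r /=; rewrite !in_itv/= !andbT.
    by move=> ->; have [rt|rt] := leP r t; [left|right].
  by case=> [/andP[]//|/ltW]; exact: le_trans.
have mf := within_continuous_measurable cf.
have mEf : measurable_fun (`[0, +oo[ : set R) (fun s => `|(EFin \o f) s|%E).
  by apply: measurableT_comp => //; exact/measurable_EFinP.
apply/integrableP; split; first exact/measurable_EFinP.
rewrite e ge0_integral_setU//; last 2 first.
- by rewrite -e.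
- rewrite disj_set2E; apply/eqP/seteqP; split => r //=; rewrite !in_itv/= andbT.
  by move=> [/andP[_ rt]]; rewrite ltNge rt.
apply: lte_add_pinfty.
  by have /integrableP[] := within_continuous_integrable t (lexx 0) cf.
have /integrableP[_] := If; apply: le_lt_trans.
apply: ge0_subset_integral => //; last by apply: subset_itvr; rewrite bnd_simp.
apply: measurable_funS mEf => // r /=; rewrite !in_itv/= !andbT; exact: le_trans.
Qed.

Variables (kappa theta psi x0 : R) (x b : R -> R).
Hypothesis cx : {within `[0, +oo[, continuous x}.
Hypothesis cb : {within `[0, +oo[, continuous b}.
Hypothesis xE : forall t, 0 <= t ->
  x t = x0 + \int[leb]_(s in `[0, t]) (kappa * (theta - x s)) + psi * (b t - b 0).

(* Variation of constants, with the stochastic integral integrated by parts. *)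
Lemma ornstein_uhlenbeck_solution (t v : R) : 0 <= t -> t <= v ->
  x v = expR (- (kappa * (v - t))) * x t + psi * (b v - b t) +
    expR (- (kappa * v)) *
    \int[leb]_(s in `[t, v]) (expR (kappa * s) * (kappa * (theta - psi * (b s - b t)))).
Proof.
move=> t0; rewrite le_eqVlt => /predU1P[<-|tv].
  rewrite !subrr mulr0 oppr0 expR0 mul1r mulr0 addr0 set_itv1 Rintegral_set1.
  by rewrite mulr0 addr0.
have v0 := lt_le_trans tv (lexx v); have {}v0 : 0 < v by exact: le_lt_trans tv.
have cf : {within `[0, +oo[, continuous (fun s => kappa * (theta - x s))}.
  move=> s; apply: cvgM; first exact: cvg_cst.
  by apply: cvgB; [exact: cvg_cst|exact: cx].
(* By [ME] this is [x] freed from its noise since [t]; being a primitive plus a constant, it is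
   differentiable. *)
pose M s := x0 + \int[leb]_(r in `[0, s]) (kappa * (theta - x r)) + psi * (b t - b 0).
have ME s : 0 <= s -> M s = x s - psi * (b s - b t).
  by move=> /xE ->; rewrite /M; ring.
have dM (s : R) : 0 < s -> is_derive s 1 M (kappa * (theta - x s)).
  move=> s_0.
  have ss1 : s < s + 1 by rewrite ltrDl.
  have [dI I'] := continuous_FTC1_closed ss1
    (within_continuous_integrable (s + 1) (lexx 0) cf) s_0 (within_continuous_in cf s_0).
  have hI : is_derive s 1 (fun s => \int[leb]_(r in `[0, s]) (kappa * (theta - x r)))
      (kappa * (theta - x s)).
    by apply: DeriveDef => //; rewrite -derive1E.
  have := is_deriveD (is_deriveD (is_derive_cst x0 s 1) hI)
    (is_derive_cst (psi * (b t - b 0)) s 1).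
  by move=> hM; apply: (is_derive_eq hM); rewrite add0r addr0.
have cM : {within `[t, v], continuous M}.
  have := @parameterized_integral_continuous R 0 v _ (ltW v0)
    (within_continuous_integrable v (lexx 0) cf).
  move=> cI; apply: (@continuous_subspaceW _ _ _ `[0, v]).
    by move=> r /=; rewrite !in_itv/= => /andP[tr ->]; rewrite (le_trans t0).
  move=> s; apply: cvgD; last exact: cvg_cst.
  by apply: cvgD; [exact: cvg_cst|exact: cI].
(* Integrating factor: in the derivative of [G] the terms in [x] cancel and only [b] remains. *)
pose G s := expR (kappa * s) * M s.
have dG (s : R) : 0 < s -> is_derive s 1 G (expR (kappa * s) * (kappa * (theta - psi * (b s - b t)))).
  move=> s_0.
  have hK : is_derive s 1 ( *%R kappa) kappa.
    have := is_deriveZ kappa (is_derive_id s 1).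
    by move=> hK; apply: (is_derive_eq hK); rewrite /GRing.scale/= mulr1.
  have hE := is_derive1_comp (is_derive_expR (kappa * s)) hK.
  have := is_deriveM hE (dM s s_0).
  move=> hG; apply: (is_derive_eq hG); rewrite /GRing.scale/= (ME _ (ltW s_0)).
  by ring.
have cE : continuous (fun s : R => expR (kappa * s)).
  move=> s; apply: continuous_comp; last exact: continuous_expR.
  exact: mulrl_continuous.
have cG : {within `[t, v], continuous G}.
  move=> s; apply: cvgM; last exact: cM.
  exact: (continuous_subspaceT cE).
have cH : {within `[0, +oo[, continuous
    (fun s => expR (kappa * s) * (kappa * (theta - psi * (b s - b t))))}.
  move=> s; apply: cvgM; first exact: (continuous_subspaceT cE).
  apply: cvgM; first exact: cvg_cst.
  apply: cvgB; first exact: cvg_cst.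
  apply: cvgM; first exact: cvg_cst.
  by apply: cvgB; [exact: cb|exact: cvg_cst].
have -> : \int[leb]_(s in `[t, v])
    (expR (kappa * s) * (kappa * (theta - psi * (b s - b t)))) = G v - G t.
  rewrite /Rintegral (@continuous_FTC2 R _ G t v tv)//.
  - apply: continuous_subspaceW cH => r /=; rewrite !in_itv/= andbT => /andP[tr _].
    exact: le_trans tr.
  - have [_ Gt Gv] := (continuous_within_itvP G tv).1 cG.
    split => // s; rewrite in_itv/= => /andP[ts _].
    by have /dG[] := le_lt_trans t0 ts.
  - move=> s; rewrite in_itv/= => /andP[ts _].
    by rewrite derive1E; have /dG := le_lt_trans t0 ts => ?; rewrite derive_val.
rewrite /G ME ?ltW// ME// subrr mulr0 subr0.
have -> : expR (- (kappa * (v - t))) = expR (- (kappa * v)) * expR (kappa * t).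
  by rewrite -expRD; congr expR; ring.
rewrite [X in _ = _ + X](_ : _ =
  (expR (- (kappa * v)) * expR (kappa * v)) * (x v - psi * (b v - b t)) -
  expR (- (kappa * v)) * expR (kappa * t) * x t); last by ring.
by rewrite -[expR (- (kappa * v)) * expR (kappa * v)]expRD addNr expR0; ring.
Qed.

End paths.

(** * Continuity of the discount factor *)

Section discounting.
Context (R : realType) (r : R -> R).
Local Notation leb := (@lebesgue_measure R).
Hypothesis hr : forall t : R, 0 <= t -> leb.-integrable `[0, t] (EFin \o r).

Lemma continuous_discount : {within `[0, +oo[, continuous (discount r)}.
Proof.
have cn (n : R) : 0 <= n -> {within `[0, n], continuous (discount r)}.
  move=> n0 s; have := @parameterized_integral_continuous R 0 n r n0 (hr n0) s.
  move=> cI; apply: continuous_comp; last exact: continuous_expR.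
  by apply: cvgN; exact: cI.
apply/continuous_within_itvcyP; split.
  move=> s; rewrite in_itv/= andbT => s0.
  have s1 : 0 < s + 1 by rewrite addr_gt0.
  have /(continuous_within_itvP _ s1)[c _ _] := cn (s + 1) (ltW s1).
  by apply: c; rewrite in_itv/= s0 ltrDl ltr01.
by have [_ c0 _] := (continuous_within_itvP (discount r) (@ltr01 R)).1 (cn 1 ler01).
Qed.

End discounting.

(** * The joint Markov property of information and dividends *)

Section markov.
Context (d : measure_display) (T : measurableType d) (R : realType)
  (P : probability T R) (beta B X : R -> {RV P >-> R})
  (r : R -> R) (kappa theta psi x0 sigma : R)
  (hbeta : is_brownian P beta) (hB : is_brownian P B)
  (hindep : indep P [set (beta t : T -> R) | t in `[0, +oo[]
                    [set (B t : T -> R) | t in `[0, +oo[])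
  (hr : forall t : R, 0 <= t ->
     (@lebesgue_measure R).-integrable `[0, t] (EFin \o r))
  (hpi : (\int[@lebesgue_measure R]_(u in `[0%R, +oo[) (discount r u)%:E < +oo)%E)
  (hkappa : 0 < kappa)
  (hX : is_ornstein_uhlenbeck P kappa theta psi x0 beta X).
Local Notation leb := (@lebesgue_measure R).
Local Notation null := (ae_zero P).
Implicit Types (s t u v : R).

Let past t := [set (beta s : T -> R) | s in `[0, t]].
Let incr t := [set (fun w => beta v w - beta t w) | v in `[t, +oo[].
Let pi := discount r.
(** The innovation of X after [t], which by variation of constants depends almost surely on the
    increments of beta after [t] alone. *)
Let noise t v : T -> R := fun w => X v w - expR (- (kappa * (v - t))) * X t w.

Let cX w : {within `[0, +oo[, continuous (fun s => X s w)}.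
Proof. by have [c _] := hX; exact: c. Qed.

Let cbeta w : {within `[0, +oo[, continuous (fun s => beta s w)}.
Proof. by have [_ c _ _] := hbeta; exact: c. Qed.

Let within_itvcy t (f : R -> R) : 0 <= t -> {within `[0, +oo[, continuous f} ->
  {within `[t, +oo[, continuous f}.
Proof.
move=> t0; apply: continuous_subspaceW => s /=; rewrite !in_itv/= !andbT.
exact: le_trans.
Qed.

Let rpast t : rvs (past t).
Proof. by apply: rvs_image => s _; exact: measurable_funP. Qed.

Let rincr t : rvs (incr t).
Proof. by apply: rvs_image => v _; exact: measurable_funB. Qed.

Let rnull : rvs null.
Proof. exact: ae_zero_rvs. Qed.

(** Variation of constants from time 0, where X_0 = x0 almost surely, expresses X_s through beta on
    [0, s]; [null] absorbs the exceptional set. *)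
Lemma ornstein_uhlenbeck_adapted s t : 0 <= s -> s <= t ->
  adapted (past t `|` null) (X s).
Proof.
move=> s0 st; have t0 := le_trans s0 st.
have past_mem v : 0 <= v -> v <= t -> adapted (past t) (beta v).
  by move=> v0 vt; apply: adapted_mem; exists v => //=; rewrite in_itv/= v0.
(* beta is stopped at t because measurable_Rintegral_process requires every
   time of the process to be adapted. *)
pose g w := expR (- (kappa * (s - 0))) * x0 + psi * (beta s w - beta 0 w) +
  expR (- (kappa * s)) * \int[leb]_(v in `[0, s])
    (expR (kappa * v) * (kappa * (theta - psi * (beta (Num.min v t) w - beta 0 w)))).
have ag : adapted (past t) g.
  apply: measurable_funD.
    apply: measurable_funD => //; apply: measurable_funM => //.
    by apply: measurable_funB; apply: past_mem.
  apply: measurable_funM => //.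
  apply: (@measurable_Rintegral_process _ (g_sigma_algebraType (sigma_gens (past t)))
    R _ 0 _ _ `[0, s] (fun v => expR (kappa * v))) => //.
  - move=> v v0; apply: measurable_funM => //; apply: measurable_funB => //.
    apply: measurable_funM => //; apply: measurable_funB; apply: past_mem => //.
    + by rewrite le_min v0.
    + by rewrite ge_min lexx orbT.
  - move=> w v; apply: cvgM; first exact: cvg_cst.
    apply: cvgB; first exact: cvg_cst.
    apply: cvgM; first exact: cvg_cst.
    apply: cvgB; last exact: cvg_cst.
    exact: (within_continuous_stop t0 (@cbeta w)).
  - by move=> v /=; rewrite !in_itv/= andbT => /andP[].
  - by apply: measurable_funTS; apply: measurableT_comp => //; exact: measurable_funM.
apply: (ae_zero_adapted ag) => //; first exact: adapted_measurable ag.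
have [_] := hX; apply: filterS => w Xw.
have X0 : X 0 w = x0.
  by rewrite (Xw 0)// set_itv1 Rintegral_set1 subrr mulr0 !addr0.
have := @ornstein_uhlenbeck_solution R kappa theta psi x0 _ _ (@cX w) (@cbeta w) Xw 0 s (lexx 0) s0.
rewrite X0 /g => ->; congr (_ + _ * _).
apply: eq_Rintegral => v; rewrite inE/= in_itv/= => /andP[_ vs].
by rewrite min_l// (le_trans vs).
Qed.

(** In the variation of constants from time [t] the term in X_t cancels. *)
Lemma noise_adapted t v : 0 <= t -> t <= v -> adapted (incr t `|` null) (noise t v).
Proof.
move=> t0 tv.
have incr_mem s : t <= s -> adapted (incr t) (fun w => beta s w - beta t w).
  by move=> ts; apply: adapted_mem; exists s => //=; rewrite in_itv/= ts.
pose g w := psi * (beta v w - beta t w) + expR (- (kappa * v)) *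
  \int[leb]_(s in `[t, v])
    (expR (kappa * s) * (kappa * (theta - psi * (beta s w - beta t w)))).
have ag : adapted (incr t) g.
  apply: measurable_funD.
    by apply: measurable_funM => //; exact: incr_mem.
  apply: measurable_funM => //.
  apply: (@measurable_Rintegral_process _ (g_sigma_algebraType (sigma_gens (incr t)))
    R _ t _ _ `[t, v] (fun v => expR (kappa * v))) => //.
  - move=> s ts; apply: measurable_funM => //; apply: measurable_funB => //.
    by apply: measurable_funM => //; exact: incr_mem.
  - move=> w s; apply: cvgM; first exact: cvg_cst.
    apply: cvgB; first exact: cvg_cst.
    apply: cvgM; first exact: cvg_cst.
    apply: cvgB; last exact: cvg_cst.
    exact: (within_itvcy t0 (@cbeta w)).
  - by move=> s /=; rewrite !in_itv/= andbT => /andP[].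
  - by apply: measurable_funTS; apply: measurableT_comp => //; exact: measurable_funM.
apply: (ae_zero_adapted ag); first exact: adapted_measurable ag.
  by apply: measurable_funB => //; exact: measurable_funM.
have [_] := hX; apply: filterS => w Xw.
rewrite /noise (@ornstein_uhlenbeck_solution R kappa theta psi x0 _ _ (@cX w) (@cbeta w) Xw t v t0 tv).
rewrite /g; ring.
Qed.

Let cpi : {within `[0, +oo[, continuous pi}.
Proof. exact: continuous_discount. Qed.

Let cpiX w : {within `[0, +oo[, continuous (fun v => pi v * X v w)}.
Proof. by move=> s; apply: cvgM; [exact: cpi|exact: cX]. Qed.

Let integrable_pi t : 0 <= t -> leb.-integrable `[t, +oo[ (EFin \o pi).
Proof.
move=> t0; apply/(integrable_itvcy_tail t0 (@cpi)).1; apply/integrableP; split.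
  by apply/measurable_EFinP; exact: (within_continuous_measurable (@cpi)).
by under eq_integral do rewrite /= ger0_norm ?expR_ge0//.
Qed.

Let convergent : set T :=
  [set w | leb.-integrable `[0, +oo[ (EFin \o (fun v => pi v * X v w))].

(** Integrability is a matter of the tail from [t] on. There X_v differs from its innovation by a
    term bounded by |X_t|, because [kappa] is positive, and this term is integrable against [pi].
    Hence the innovation alone decides. *)
Lemma convergent_tail_event t : 0 <= t -> events (incr t `|` null) convergent.
Proof.
move=> t0.
have mpi : measurable_fun (`[t, +oo[ : set R) pi.
  by apply/measurable_EFinP; exact: (measurable_int leb (integrable_pi t0)).
have cn w : {within `[t, +oo[, continuous (fun v => noise t v w)}.
  move=> s; apply: cvgB; first exact: (within_itvcy t0 (@cX w)).
  apply: cvgM; last exact: cvg_cst.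
  apply: (@continuous_subspaceT _ _ _ (fun v => expR (- (kappa * (v - t))))).
  move=> v; apply: continuous_comp; last exact: continuous_expR.
  apply: cvgN; apply: cvgM; first exact: cvg_cst.
  by apply: cvgB; [exact: cvg_id|exact: cvg_cst].
have mn w : measurable_fun (`[t, +oo[ : set R) (fun v => noise t v w).
  by apply: subspace_continuous_measurable_fun => //; exact: (@cn w).
have mt : measurable (`[t, +oo[%classic : set (measurableTypeR R)) by exact: measurable_itv.
have Idec w : leb.-integrable `[t, +oo[ (EFin \o
    (fun v => pi v * (expR (- (kappa * (v - t))) * X t w))).
  have := integrableZr mt (X t w) (integrable_pi t0) => IpiX.
  apply: le_integrable IpiX => //.
    apply/measurable_EFinP; apply: measurable_funM => //.
    apply: measurable_funM => //; apply: measurable_funTS.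
    apply: measurableT_comp => //; apply: measurableT_comp => //.
    by apply: measurable_funM => //; exact: measurable_funB.
  move=> v; rewrite /= in_itv/= andbT => tv.
  rewrite lee_fin !normrM ler_wpM2l// ler_piMl//.
  rewrite ger0_norm ?expR_ge0// -[leRHS]expR0 ler_expR oppr_le0.
  by apply: mulr_ge0; [exact: ltW|rewrite subr_ge0].
have -> : convergent = setT `&`
    [set w | (\int[leb]_(v in `[t, +oo[) `|(pi v * noise t v w)%:E| < +oo)%E].
  rewrite setTI; apply/seteqP; split => w /=.
    move=> /(integrable_itvcy_tail t0 (@cpiX w)).1 IX.
    have /integrableP[_ //] : leb.-integrable `[t, +oo[ (EFin \o (fun v => pi v * noise t v w)).
    have := integrableB mt IX (Idec w).
    apply: eq_integrable => // v _.
    by rewrite /= -EFinB /noise; congr (_%:E); ring.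
  move=> nfin; apply/(integrable_itvcy_tail t0 (@cpiX w)).2.
  have In : leb.-integrable `[t, +oo[ (EFin \o (fun v => pi v * noise t v w)).
    by apply/integrableP; split => //; apply/measurable_EFinP; exact: (measurable_funM mpi (mn w)).
  have := integrableD mt In (Idec w).
  apply: eq_integrable => // v _.
  by rewrite /= -EFinD /noise; congr (_%:E); ring.
apply: (@emeasurable_fun_infty_o _ (g_sigma_algebraType (sigma_gens (incr t `|` null)))) => //.
apply: (@measurable_integral_norm_process _
  (g_sigma_algebraType (sigma_gens (incr t `|` null))) R (noise t) t) => //.
by move=> v tv; exact: noise_adapted.
Qed.

Lemma past_incr_indep t : 0 <= t -> indep P (past t) (incr t `|` null).
Proof.
move=> t0; apply: indepC; apply: indep_joinl_ae_zero => //.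
by apply: indepC; exact: brownian_future_indep.
Qed.

(* Kolmogorov's argument: convergence of the dividend integral depends only on
   the increments of beta after t, for every t. *)
Lemma convergent_01 : P convergent = 0%E \/ P (~` convergent) = 0%E.
Proof.
have mC : measurable convergent.
  by apply: events_measurable (convergent_tail_event (lexx 0)); exact: rvsU.
(* The event enters as the family of its indicator, in order to be shown independent of itself. *)
have ind : indep P (incr 0 `|` null) [set \1_convergent : T -> R].
  apply: indep_joinl_ae_zero => //.
    by apply: rvs1; exact: measurable_indic.
  apply: indep_directed => //.
  - by apply: rvs1; exact: measurable_indic.
  - by move=> v _; exact: measurable_funB.
  move=> l l0.
  (* The finitely many increments in question are known at time [m], whereas the event is determined
     by those after [m], up to null sets. *)
  pose m := \big[Num.max/0]_(v <- l) v.
  have m0 : 0 <= m by exact: bigmax_ge_id.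
  apply: indepS (past_incr_indep m0) => [_ [v vl <-]|_ ->].
    have := l0 _ vl; rewrite /= in_itv/= andbT => v0.
    have vm : v <= m by apply: le_bigmax_seq vl _.
    by apply: measurable_funB; apply: adapted_mem; [exists v|exists 0] => //=;
      rewrite in_itv/= ?v0 ?lexx.
  exact: (@measurable_indic _ (g_sigma_algebraType _) _ _ _ (convergent_tail_event m0)).
have := ind convergent convergent (convergent_tail_event (lexx 0)).
have : events [set \1_convergent : T -> R] convergent.
  rewrite [X in events _ X](_ : _ = (\1_convergent : T -> R) @^-1` [set 1]).
    by apply: adapted_preimage; [exact: adapted_mem|exact: measurable_set1].
  apply/seteqP; split => w; rewrite /preimage/= indicE.
    by move=> /mem_set ->.
  by have [/set_mem//|_ /esym/eqP] := boolP (w \in convergent); rewrite oner_eq0.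
move=> Cev /(_ Cev); rewrite setIid.
have PE : P convergent = (fine (P convergent))%:E by rewrite fineK// fin_num_measure.
rewrite probability_setC//.
rewrite PE -EFinM => -[] pp.
have [->|p0] := eqVneq (fine (P convergent)) 0; first by left.
right; rewrite -EFinB; congr (_%:E).
by apply/eqP; rewrite subr_eq0; apply/eqP/(mulfI p0); rewrite mulr1.
Qed.

Let xi := information r sigma (fun t => X t : T -> R) (fun t => B t : T -> R).
Let W0 s : T -> R := fun w => B s w - B 0 w.

Let B0_null : null (B 0).
Proof. by have [B0 _ _ _] := hB; split. Qed.

Let B_adapted F s : adapted F (W0 s) -> adapted (F `|` null) (B s).
Proof.
move=> aW; have -> : (B s : T -> R) = W0 s \+ B 0.
  by apply/funext => w; rewrite /W0 /= subrK.
apply: measurable_funD; first by apply: adapted_sub aW => ?; left.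
by apply: adapted_mem; right.
Qed.

Let xi_adapted F t : 0 <= t -> (forall v, t <= v -> adapted F (X v)) ->
  adapted F (B t) -> adapted F (xi t).
Proof.
move=> t0 aX aB; apply: measurable_funD => //; apply: measurable_funM => //.
apply: (@measurable_Rintegral_process _ (g_sigma_algebraType (sigma_gens F))
    R (fun v => X v : T -> R) t) => //.
- by move=> w; exact: (within_itvcy t0 (@cX w)).
- by apply/measurable_EFinP; exact: (measurable_int leb (integrable_pi t0)).
Qed.

Let mxi t : 0 <= t -> measurable_fun setT (xi t).
Proof.
move=> t0; apply: (@adapted_measurable _ _ _ [set f : T -> R | measurable_fun setT f]) => //.
by apply: xi_adapted => // [v _|]; apply: adapted_mem; exact: measurable_funP.
Qed.

(** For [t] = 0 the index interval is empty and there are no bridges. *)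
Lemma bridge_indep t u : 0 <= t -> t <= u ->
  indep P [set (fun w => W0 s w - s / t * W0 t w) | s in `]0, t]] [set W0 t; W0 u].
Proof.
rewrite le_eqVlt => /predU1P[<-|t0] tu; last exact: brownian_bridge_indep.
apply: (@indepS _ _ _ _ null [set W0 0; W0 u]) => //.
- by move=> f [s]; rewrite /= in_itv/= => /andP[/lt_le_trans/[apply]]; rewrite ltxx.
- by move=> f; exact: adapted_mem.
- by apply/indepC/indep_ae_zero; apply: rvsU; apply: rvs1; exact: measurable_funB.
Qed.

(** Difference of the tail integrals at [s] and [t]: on divergent paths both are 0 by default,
    whence the second branch. The alternative is a parameter, so that the random one can be
    exchanged for a constant. *)
Let dividends (C : bool) s t : T -> R := fun w =>
  if C then \int[leb]_(v in `[s, t]) (pi v * X v w) else 0.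

Let information_decomposition s t w : 0 <= s -> s <= t -> B 0 w = 0 ->
  xi s w = sigma * s * dividends `[< convergent w >] s t w + s / t * xi t w +
    (W0 s w - s / t * W0 t w).
Proof.
move=> s0 st B0; rewrite /xi /information /W0 B0 !subr0.
have -> : \int[leb]_(u in `[s, +oo[) (discount r u * X u w) =
    dividends `[< convergent w >] s t w +
    \int[leb]_(u in `[t, +oo[) (discount r u * X u w).
  rewrite /dividends; have [cw|ncw] := pselect (convergent w).
    by rewrite asboolT// (Rintegral_itvcy_split s0 st cw).
  have t0 := le_trans s0 st.
  have z v : 0 <= v -> \int[leb]_(u in `[v, +oo[) (discount r u * X u w) = 0.
    move=> v0; apply: Rintegral_not_integrable => //.
      apply: measurable_funS (within_continuous_measurable (@cpiX w)) => //.
      by move=> x /=; rewrite !in_itv/= !andbT; exact: le_trans.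
    by move=> /(integrable_itvcy_tail v0 (@cpiX w)).2.
  by rewrite asboolF// !z// addr0.
(* This case includes [t] = 0, where one cannot divide by [t]. *)
have [s00|s_0] := eqVneq s 0; first by rewrite s00 B0 mulr0 !mul0r; ring.
have t_0 : t != 0 by rewrite gt_eqF// (lt_le_trans _ st)// lt_neqAle eq_sym s_0.
by field.
Qed.

(** [cond_prob_markov] with x = X_t and y = xi_t, for the two independent families described at the
    head, each completed by null sets. *)
Lemma information_markov t u (a b : R) : 0 <= t -> t <= u ->
  {ae P, forall w,
    cond_prob P ([set w' | xi u w' < a] `&` [set w' | X u w' < b])
      ([set xi s | s in `[0, t]] `|` [set (X s : T -> R) | s in `[0, t]]) w
    = cond_prob P ([set w' | xi u w' < a] `&` [set w' | X u w' < b])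
      [set xi t; (X t : T -> R)] w}.
Proof.
move=> t0 tu; have u0 := le_trans t0 tu.
pose br := [set (fun w => W0 s w - s / t * W0 t w) | s in `]0, t]].
pose F1 := (past t `|` br) `|` null.
pose F2 := (incr t `|` [set W0 t; W0 u]) `|` null.
have mW0 s : measurable_fun setT (W0 s) by exact: measurable_funB.
have rbr : rvs br.
  by apply: rvs_image => s _; apply: measurable_funB => //; exact: measurable_funM.
have rW : rvs [set W0 t; W0 u] by apply: rvsU; exact: rvs1.
have rF1 : rvs F1 by apply: rvsU => //; exact: rvsU.
have rF2 : rvs F2 by apply: rvsU => //; exact: rvsU.
have F12 : indep P F1 F2.
  apply: indep_ae_zeroU; [exact: rvsU|exact: rvsU|].
  apply: indep_cross => //.
  - exact: brownian_future_indep.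
  - exact: bridge_indep.
  have mem (W : R -> {RV P >-> R}) s : 0 <= s ->
      adapted [set (W t : T -> R) | t in `[0, +oo[] (W s).
    by move=> s0; apply: adapted_mem; exists s => //=; rewrite in_itv/= s0.
  have memW0 s : 0 <= s -> adapted [set (B t : T -> R) | t in `[0, +oo[] (W0 s).
    by move=> s0; apply: measurable_funB; exact: mem.
  apply: indepS hindep => f.
    move=> [[s /= + <-]|[v /= + <-]]; rewrite in_itv/=.
      by move=> /andP[s0 _]; exact: mem.
    rewrite andbT => tv; apply: measurable_funB; apply: mem => //.
    exact: le_trans tv.
  move=> [[s /= + <-]|[->|->]]; rewrite ?in_itv/=; try exact: memW0.
  move=> /andP[/ltW s0 _]; apply: measurable_funB; first exact: memW0.
  by apply: measurable_funM => //; exact: memW0.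
have past_null : past t `|` null `<=` F1 by move=> f [pf|nf]; [left; left|right].
have incr_null : incr t `|` null `<=` F2 by move=> f [pf|nf]; [left; left|right].
have XF1 s : 0 <= s -> s <= t -> adapted F1 (X s).
  by move=> s0 st; apply: adapted_sub past_null _; exact: ornstein_uhlenbeck_adapted.
pose K := [set (X t : T -> R)] `|` F2.
have XK v : t <= v -> adapted K (X v).
  move=> tv; have -> : (X v : T -> R) =
      noise t v \+ (fun w => expR (- (kappa * (v - t))) * X t w).
    by apply/funext => w; rewrite /noise /= subrK.
  apply: measurable_funD.
    apply: (@adapted_sub _ _ _ (incr t `|` null)) (noise_adapted t0 tv).
    by move=> f /incr_null; right.
  by apply: measurable_funM => //; apply: adapted_mem; left.
have BK v : v = t \/ v = u -> adapted K (B v).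
  move=> vE; apply: (@adapted_sub _ _ _ ([set W0 t; W0 u] `|` null)).
    by move=> f [Wf|nf]; right; [left; right|right].
  by apply: B_adapted; apply: adapted_mem; case: vE => ->; [left|right].
have xitK : adapted K (xi t) by apply: xi_adapted => //; apply: BK; left.
have xiuK : adapted K (xi u).
  by apply: xi_adapted => //; [move=> v /(le_trans tu); exact: XK|apply: BK; right].
have lt_event (f : T -> R) (c : R) : adapted K f -> events K [set w | f w < c].
  move=> Kf; rewrite (_ : [set w | f w < c] = f @^-1` `]-oo, c[).
    exact: adapted_preimage.
  by apply/seteqP; split => w; rewrite /preimage/= in_itv.
apply: (cond_prob_markov rF1 rF2 F12 (XF1 t t0 (lexx t)) xitK).
- by apply: eventsI; apply: lt_event => //; exact: XK.
- by right; exists t => //=; rewrite in_itv/= t0 lexx.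
- by left; exists t => //=; rewrite in_itv/= t0 lexx.
move=> f [[s /= + <-]|[s /= + <-]]; rewrite in_itv/= => /andP[s0 st]; last first.
  by apply: adapted_sub (XF1 s s0 st) => g; left.
(* Convergence has probability 0 or 1, so the alternative in [dividends] may be taken deterministic
   although it refers to the whole future of the path. *)
have [C aeC] : exists C : bool, {ae P, forall w, `[< convergent w >] = C}.
  have mC : measurable convergent.
    by apply: events_measurable (convergent_tail_event (lexx 0)); exact: rvsU.
  case: convergent_01 => C0; [exists false|exists true].
    exists convergent; split => // w /=; apply: contra_notP => nw.
    by rewrite asboolF.
  exists (~` convergent); split => //; first exact: measurableC.
  by move=> w /=; apply: contra_not => nw; rewrite asboolT.
(* Almost surely equal to [xi s] by the decomposition, and a function of [F1] and [xi t]. *)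
pose g w := sigma * s * dividends C s t w + s / t * xi t w + (W0 s w - s / t * W0 t w).
have ag : adapted (F1 `|` [set xi t]) g.
  apply: measurable_funD; first apply: measurable_funD.
  - apply: measurable_funM => //; apply: (@adapted_sub _ _ _ F1); first by move=> ?; left.
    rewrite /dividends; case: (C); last exact: measurable_cst.
    (* X is stopped at [t] so that all its times are adapted to [F1]. *)
    rewrite (_ : (fun w => _) = fun w =>
        \int[leb]_(v in `[s, t]) (pi v * X (Num.min v t) w)); last first.
      apply/funext => w; apply: eq_Rintegral => v; rewrite inE/= in_itv/= => /andP[_ vt].
      by rewrite min_l.
    apply: (@measurable_Rintegral_process _ (g_sigma_algebraType (sigma_gens F1))
      R (fun v => X (Num.min v t) : T -> R) 0) => //.
    + by move=> v v0; apply: XF1; rewrite ?le_min ?v0// ge_min lexx orbT.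
    + by move=> w; exact: (within_continuous_stop t0 (@cX w)).
    + move=> v /=; rewrite !in_itv/= andbT => /andP[sv _]; exact: le_trans sv.
    + apply: measurable_funS (within_continuous_measurable (@cpi)) => //.
      move=> v /=; rewrite !in_itv/= andbT => /andP[sv _]; exact: le_trans sv.
  - by apply: measurable_funM => //; apply: adapted_mem; right.
  (* The time 0 is missing from the index interval of [br], but the bridge vanishes there. *)
  - have [->|s_0] := eqVneq s 0.
      rewrite (_ : (fun w => _) = cst 0); first exact: measurable_cst.
      by apply/funext => w; rewrite /W0 subrr !mul0r subrr.
    apply: adapted_mem; left; left; right; exists s => //=.
    by rewrite in_itv/= st lt_neqAle eq_sym s_0 s0.
have mg : measurable_fun setT g.
  by apply: adapted_measurable ag; apply: rvsU => //; apply: rvs1; exact: mxi.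
(* [F1] already contains [null], so the completion adds nothing. *)
apply: (@adapted_sub _ _ _ (F1 `|` [set xi t] `|` null)).
  by move=> h [//|nh]; left; right.
apply: (ae_zero_adapted ag mg (mxi s0)).
have [B0 _ _ _] := hB.
by apply: filterS2 aeC B0 => w Cw B0w; rewrite (information_decomposition s0 st B0w) Cw.
Qed.

End markov.

Theorem proposition3 (d : measure_display) (T : measurableType d) (R : realType)
  (P : probability T R) (beta B X : R -> {RV P >-> R})
  (r : R -> R) (kappa theta psi x0 sigma : R)
  (hbeta : is_brownian P beta) (hB : is_brownian P B)
  (hindep : indep P [set (beta t : T -> R) | t in `[0, +oo[]
                    [set (B t : T -> R) | t in `[0, +oo[])
  (hr : forall t : R, 0 <= t ->
     (@lebesgue_measure R).-integrable `[0, t] (EFin \o r))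
  (hpi : (\int[@lebesgue_measure R]_(u in `[0%R, +oo[) (discount r u)%:E < +oo)%E)
  (hkappa : 0 < kappa) (hpsi : 0 < psi) (hsigma : 0 < sigma)
  (hX : is_ornstein_uhlenbeck P kappa theta psi x0 beta X) :
  let xi : R -> T -> R :=
    information r sigma (fun t => X t : T -> R) (fun t => B t : T -> R) in
  forall t u a b : R, 0 <= t -> t <= u ->
    {ae P, forall w,
      cond_prob P ([set w' | xi u w' < a] `&` [set w' | X u w' < b])
        ([set xi s | s in `[0, t]] `|` [set (X s : T -> R) | s in `[0, t]]) w
      = cond_prob P ([set w' | xi u w' < a] `&` [set w' | X u w' < b])
        [set xi t; (X t : T -> R)] w}.
Proof.
by move=> xi t u a b t0 tu; exact: (information_markov _ hbeta hB hindep hr hpi hkappa hX).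
Qed.
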